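(* Let $(H,B,\mu)$ be an abstract Wiener space, $f\in L^2(B,\mu)$, and let $Q_0$ be a closed subspace of $H$ of finite codimension. Let $\{u_1,\dots,u_n\}$ be an orthonormal basis of $Q_0^{\perp}$. Then for all $\alpha=(\alpha_1,\dots,\alpha_n)\in\mathbb{C}^n$, $$\bigl(S_{Q_0^{\perp}}(G_{Q_0}f)\bigr)(\alpha_{Q_0^{\perp}})=(S_Bf)(\alpha_{Q_0^{\perp}}),$$ where $\alpha_{Q_0^{\perp}}=\alpha_1u_1+\dots+\alpha_nu_n\in (Q_0^{\perp})_{\mathbb{C}}$, and $S_{Q_0^{\perp}}$ and $S_B$ are the Segal-Bargmann transforms on $L^2(Q_0^{\perp},\gamma_{Q_0^{\perp}})$ and $L^2(B,\mu)$ respectively.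
   Context: Abstract Wiener space: $H$ is a real separable Hilbert space with inner product $\langle\cdot,\cdot\rangle$ and norm $\|\cdot\|$; $B$ is the Banach space obtained by completing $H$ with respect to a measurable norm $|\cdot|$ (in the sense of L. Gross), so $H\subset B$ is continuously and densely embedded. For $x^*\in B^*$, the restriction $x^*|_H$ is $\|\cdot\|$-continuous, and $h_{x^*}\in H$ denotes the unique element with $\langle h_{x^*},\cdot\rangle=x^*|_H$. $(x,x^* )$ denotes the pairing of $x\in B$ with $x^*\in B^*$. Wiener measure $\mu$ is the Borel probability measure on $B$ with $$\int_B e^{i(x,x^* )}\,d\mu(x)=e^{-\frac12\|h_{x^*}\|^2}\quad\text{for all }x^*\in B^*.$$ Paley-Wiener map: $I:H\to L^2(B,\mu)$ is the unique continuous linear extension of $h_{x^*}\mapsto(\cdot,x^* )$ (defined on the dense subspace $\{h_{x^*}:x^*\in B^*\}$ of $H$). Measures $\mu_{Q_p}$ (known fact, used as definition): for a closed subspace $M_0\subset H$ and $p\in M_0^{\perp}$ (orthogonal complement in $H$), there is a unique Borel probability measure $\mu_{M_p}$ on $B$ with $$\int_B e^{i(x,x^* )}\,d\mu_{M_p}(x)=e^{i(p,x^* )-\frac12\|P_{M_0}h_{x^*}\|^2}\quad\text{for all }x^*\in B^*,$$ where $P_{M_0}$ is the orthogonal projection of $H$ onto $M_0$; it is concentrated on $p+\overline{M_0}$, with $\overline{M_0}$ the closure of $M_0$ in $B$. $\mu_{Q_p}$ is this measure for $M_0=Q_0$. $G_{Q_0}f(p):=\int_B f\,d\mu_{Q_p}$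 for $p\in Q_0^{\perp}$, computed with any Borel representative of $f$; it is defined for $\gamma_{Q_0^\perp}$-almost every $p$ and gives an element of $L^2(Q_0^{\perp},\gamma_{Q_0^{\perp}})$, where $\gamma_{Q_0^{\perp}}$ is the standard Gaussian measure on the finite-dimensional space $Q_0^{\perp}$. Segal-Bargmann transforms: $H_{\mathbb{C}}=H\oplus iH$ is the complexification of $H$, and $(z,w)$ denotes the complex bilinear extension of $\langle\cdot,\cdot\rangle$ to $H_{\mathbb{C}}$. For $z=h+ik$ with $h,k\in H$, put $\widetilde z=\widetilde h+i\widetilde k$, where $\widetilde h,\widetilde k$ are any representatives of $Ih,Ik$. For $f\in L^2(B,\mu)$ and $z\in H_{\mathbb{C}}$, $$(S_Bf)(z)=e^{-\frac12(z,z)}\int_B e^{\widetilde z(x)}f(x)\,d\mu(x).$$ For $g\in L^2(Q_0^{\perp},\gamma_{Q_0^{\perp}})$ and $z\in(Q_0^{\perp})_{\mathbb{C}}$, $$(S_{Q_0^{\perp}}g)(z)=e^{-\frac12(z,z)}\int_{Q_0^{\perp}}e^{(z,p)}g(p)\,d\gamma_{Q_0^{\perp}}(p).$$ *)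

(* Defs.v *)
From HB Require Import structures.
From mathcomp Require Import all_boot all_order all_algebra.
From mathcomp Require Import sesquilinear.
From mathcomp Require Import all_classical all_reals all_analysis.
From mathcomp Require Export complex.

Set Implicit Arguments.
Unset Strict Implicit.
Unset Printing Implicit Defensive.

Import Order.TTheory GRing.Theory Num.Theory.
Import numFieldNormedType.Exports.

Local Open Scope classical_set_scope.
Local Open Scope ring_scope.
Local Open Scope complex_scope.

Notation borel T := (g_sigma_algebraType (@open T)).

(* Avoids ['Re] and ['Im] of numClosedFieldType. *)
Local Notation Re := complex.Re.
Local Notation Im := complex.Im.

Definition cexp (R : realType) (z : R[i]) : R[i] :=
  (expR (Re z) * cos (Im z)) +i* (expR (Re z) * sin (Im z)).

Definition cintegral d (T : measurableType d) (R : realType)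
    (mu : {measure set T -> \bar R}) (D : set T) (f : T -> R[i]) : R[i] :=
  (\int[mu]_(x in D) Re (f x)) +i* (\int[mu]_(x in D) Im (f x)).

Definition cL2 d (T : measurableType d) (R : realType)
    (mu : {measure set T -> \bar R}) (f : T -> R[i]) : Prop :=
  (fun x => Re (f x)) \in Lfun mu 2%:E /\
  (fun x => Im (f x)) \in Lfun mu 2%:E.

(** The pair [(h, k)] stands for h + ik. *)
Definition complexification (R : realType) (V : lmodType R) : Type :=
  (V * V)%type.

Section Complexification.
Context (R : realType) (V : lmodType R).
Local Notation VC := (complexification V).

HB.instance Definition _ := GRing.Zmodule.copy VC (V * V)%type.

Definition complexification_scale (a : R[i]) (z : VC) : VC :=
  (Re a *: z.1 - Im a *: z.2, Re a *: z.2 + Im a *: z.1).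

Fact complexification_scaleA a b z :
  complexification_scale a (complexification_scale b z)
  = complexification_scale (a * b) z.
Proof.
case: a b z => [a1 a2] [b1 b2] [h k].
rewrite /complexification_scale /=; congr (_, _);
  rewrite !(scalerBr, scalerDr, scalerBl, scalerDl, scalerA).
- by rewrite !opprD (addrC (- (_ *: k)) (- (_ *: h))) addrACA.
- by rewrite (addrC (_ *: h)) addrACA.
Qed.

Fact complexification_scale1 : left_id 1 complexification_scale.
Proof.
by case=> h k; rewrite /complexification_scale /= !scale1r !scale0r subr0 addr0.
Qed.

Fact complexification_scaleDr :
  right_distributive complexification_scale +%R.
Proof.
move=> a [h k] [h' k']; rewrite /complexification_scale /=; congr (_, _).
- by rewrite !scalerDr opprD addrACA.
- by rewrite !scalerDr addrACA.
Qed.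

Fact complexification_scaleDl z : {morph complexification_scale^~ z : a b / a + b}.
Proof.
case: z => h k [a1 a2] [b1 b2]; rewrite /complexification_scale /=.
congr (_, _).
- by rewrite !scalerDl opprD addrACA.
- by rewrite !scalerDl addrACA.
Qed.

HB.instance Definition _ := GRing.Zmodule_isLmodule.Build R[i] VC
  complexification_scaleA complexification_scale1
  complexification_scaleDr complexification_scaleDl.

Definition to_complexification (h : V) : VC := (h, 0).

(** Complex bilinear (not sesquilinear) extension of a real bilinear form *)
Definition bilinear_ext (b : V -> V -> R) (z w : VC) : R[i] :=
  (b z.1 w.1 - b z.2 w.2) +i* (b z.1 w.2 + b z.2 w.1).

End Complexification.

Section Hilbert.
Context (R : realType) (H : completeNormedModType R).
Variable ip : {dot H for idfun}.

Definition orthonormal_basis (M : set H) n (u : 'I_n -> H) : Prop :=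
  (forall i j, ip (u i) (u j) = (i == j)%:R) /\
  M = range (fun c : 'I_n -> R => \sum_i c i *: u i).

Definition closed_subspace (M : set H) : Prop :=
  [/\ closed M, M 0 & forall (a : R) x y, M x -> M y -> M (a *: x + y)].

Definition finite_codimension (M : set H) : Prop :=
  exists m (v : 'I_m -> H), forall x,
    exists c : 'I_m -> R, M (x - \sum_i c i *: v i).

Definition orthogonal_complement (M : set H) : set H :=
  [set p | forall q, M q -> ip q p = 0].

Definition orthogonal_projection (M : set H) (h : H) : H :=
  xget 0 [set m | M m /\ orthogonal_complement M (h - m)].

(** [gamma] is the standard Gaussian measure of the finite-dimensional subspace
    [M]: it is carried by [M], and the coordinates in an orthonormal basis of
    [M] are independent N(0,1) variables. By rotation invariance the choice of
    the basis is immaterial. *)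
Definition standard_gaussian (M : set H) (gamma : probability (borel H) R) :
    Prop :=
  gamma M = 1%E /\
  exists n (e : 'I_n -> H), orthonormal_basis M e /\
    forall A : 'I_n -> set R, (forall i, measurable (A i)) ->
      gamma [set p | forall i, A i (ip (e i) p)]
      = (\prod_(i < n) normal_prob 0 1 (A i))%E.

(** Measurability of a norm [N] in the sense of L. Gross. Finite-rank
    orthogonal projections P are represented by their ranges M; the Gauss
    cylinder measure of {h | N (P h) > eps} is the standard Gaussian measure of
    {p in M | N p > eps}. *)
Definition gross_measurable (N : H -> R) : Prop :=
  forall eps : R, 0 < eps ->
  exists (M0 : set H) m (e : 'I_m -> H), orthonormal_basis M0 e /\
    forall (M : set H) (gamma : probability (borel H) R),
      M `<=` orthogonal_complement M0 ->
      standard_gaussian M gamma ->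
      (gamma [set p | M p /\ (eps < N p)%R] < eps%:E)%E.

End Hilbert.

Section WienerSpace.
Context (R : realType) (H B : completeNormedModType R).
Variables (ip : {dot H for idfun}) (j : {linear H -> B}).

(** The vector h_{x*} of H representing the functional x* restricted to H *)
Definition riesz_vector (xs : {scalar B}) : H :=
  xget 0 [set h | forall k, ip h k = xs (j k)].

(** [nu] is the measure mu_{M_p} on B *)
Definition affine_gaussian (M : set H) (p : H) (nu : probability (borel B) R) :
    Prop :=
  forall xs : {scalar B}, continuous (xs : B -> R) ->
    cintegral nu setT (fun x => cexp (0 +i* xs x))
    = cexp ((- 2^-1 * `|orthogonal_projection ip M (riesz_vector xs)| ^+ 2)
            +i* xs (j p)).

Definition wiener_measure (mu : probability (borel B) R) : Prop :=
  forall xs : {scalar B}, continuous (xs : B -> R) ->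
    cintegral mu setT (fun x => cexp (0 +i* xs x))
    = cexp (- 2^-1 * `|riesz_vector xs| ^+ 2)%:C.

(** The completion B of H is given by the embedding [j], and the measurable
    norm on H is the norm of B read through [j]. *)
Record abstract_wiener_space (mu : probability (borel B) R) : Prop := {
  aws_norm : forall h : H, `|h| ^+ 2 = ip h h ;
  aws_separable : exists2 D : set H, countable D & dense D ;
  aws_injective : injective j ;
  aws_continuous : continuous (j : H -> B) ;
  aws_dense : dense (range j) ;
  aws_measurable : gross_measurable ip (fun h => `|j h|) ;
  aws_wiener : wiener_measure mu }.

Variable mu : probability (borel B) R.

(** [I h] is a representative of the class Ih in L^2(B, mu); linearity therefore
    holds almost everywhere. *)
Definition paley_wiener (I : H -> borel B -> R) : Prop :=
  [/\ forall h, I h \in Lfun mu 2%:E,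
      forall (a : R) h k,
        {ae mu, forall x, I (a *: h + k) x = a * I h x + I k x},
      forall h0,
        (fun h => Lnorm mu 2%:E (fun x => (I h x - I h0 x)%:E)) @ h0 --> 0%E &
      forall xs : {scalar B}, continuous (xs : B -> R) ->
        {ae mu, forall x, I (riesz_vector xs) x = xs x}].

Definition segal_bargmann (I : H -> borel B -> R) (f : borel B -> R[i])
    (z : complexification H) : R[i] :=
  cexp (- (2^-1)%:C * bilinear_ext ip z z) *
  cintegral mu setT (fun x => cexp (I z.1 x +i* I z.2 x) * f x).

(** Segal-Bargmann transform on L^2(M, gamma), with M finite-dimensional *)
Definition segal_bargmann_fin (M : set H) (gamma : probability (borel H) R)
    (g : H -> R[i]) (z : complexification H) : R[i] :=
  cexp (- (2^-1)%:C * bilinear_ext ip z z) *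
  cintegral gamma M
    (fun p => cexp (bilinear_ext ip z (to_complexification p)) * g p).

(** The transform G_{Q_0} f, where [muQ p] is the measure mu_{Q_p} *)
Definition gaussian_radon (muQ : H -> probability (borel B) R)
    (f : borel B -> R[i]) (p : H) : R[i] :=
  cintegral (muQ p) setT f.

End WienerSpace.

(* Main.v *)
(** Let pi be the orthogonal projection of H onto the finite-dimensional space
    Q0^perp. A Borel probability measure on the separable space B is determined
    by its characteristic function. Comparing characteristic functions,
    mu_{Q_p} is the translate of mu_{Q_0} by p, and mu is the image of
    gamma x mu_{Q_0} under T(p, y) = pi p + y. For h in Q0^perp the Paley-Wiener
    functional I h composed with T is <h, p> almost everywhere: approximate h by
    vectors h_{x*}, for which x*(pi p + y) = <h_{x*}, pi p> + x*(y), and note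
    that the variance of x* under mu_{Q_0} is the squared distance of h_{x*} to
    Q0^perp, hence small. The identity is then Fubini's theorem, where
    integrability comes from e^{<h, p>} and f o T being square integrable. *)

Require Import Defs.
From HB Require Import structures.
From mathcomp Require Import all_boot all_order all_algebra.
From mathcomp Require Import sesquilinear.
From mathcomp Require Import all_classical all_reals all_analysis.
From mathcomp Require Import complex.
From mathcomp Require Import measurable_realfun ring lra.

Set Implicit Arguments.
Unset Strict Implicit.
Unset Printing Implicit Defensive.

Import Order.TTheory GRing.Theory Num.Theory.
Import numFieldNormedType.Exports.

Local Open Scope classical_set_scope.
Local Open Scope ring_scope.
Local Open Scope complex_scope.

(** * Trigonometric closure *)

(** Under [mu] a functional [xs] is a centred Gaussian whose variance is the squared norm of its
    Riesz vector. In the image under [T], the [gamma] part carries the coordinates of that vector in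
    the complement of [Q0], and the [muQ 0] part carries its projection to [Q0]. Pythagoras adds the
    two variances up, which is why the characteristic functions coincide. Passing from functionals
    to Borel sets of [B] takes enough functionals: Hahn-Banach gives norming ones, and separability
    lets countably many of them describe every ball. Nothing is known in advance about how [muQ p]
    varies with [p]. Measurability of the Radon transform comes from writing it, on the complement
    of [Q0], as a fibre integral over the single measure [muQ 0], to which Fubini applies. Complex
    integrals are pairs of real ones, so characteristic functions are handled as integrals of
    [cos (l + a)] with a free phase [a]: a quarter period turns cosine into sine, and fixing [p]
    merely shifts the phase. *)

Section TrigClosure.
Context (R : realType) (T : Type) (L : set (T -> R)).

(* Two measures that agree on the functions [cos (l + a)] agree on this closure,
   and the closure contains the indicators of the half-spaces [b < l]: this
   replaces Fourier inversion in the proof that characteristic functions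
   determine measures. *)
Inductive trig_closure : (T -> R) -> Prop :=
| trig_closure_cos l a : L l -> trig_closure (fun x => cos (l x + a))
| trig_closure_lin (c : R) f g : trig_closure f -> trig_closure g ->
    trig_closure (fun x => c * f x + g x)
| trig_closure_lim (F : nat -> T -> R) f (M : R) :
    (forall n, trig_closure (F n)) -> (forall n x, `|F n x| <= M) ->
    (forall x, F n x @[n --> \oo] --> f x) -> trig_closure f.

Lemma trig_closure_bounded f : trig_closure f -> exists M, forall x, `|f x| <= M.
Proof.
elim=> [l a _|c g h _ [M gM] _ [N hN]|F g M _ _ FM Fg].
- by exists 1 => x; rewrite ler_norml cos_geN1 cos_le1.
- exists (`|c| * M + N) => x; rewrite (le_trans (ler_normD _ _))//.
  by rewrite lerD// normrM ler_wpM2l.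
- exists M => x; apply: (@closed_cvg _ _ \oo _ (fun n => `|F n x|) [set y | y <= M]).
  + exact: closed_le.
  + by apply: nearW => n; exact: FM.
  + exact: cvg_norm.
Qed.

Hypothesis L0 : L (cst 0).
Hypothesis Llin : forall (c : R) l l', L l -> L l' -> L (fun x => c * l x + l' x).

Lemma trig_closure_cst c : trig_closure (cst c).
Proof.
have t1 : trig_closure (cst 1).
  by have := trig_closure_cos 0 L0; rewrite /= addr0 cos0.
have t0 : trig_closure (cst 0).
  have := trig_closure_lin (-1) t1 t1.
  by congr trig_closure; apply/funext => x /=; ring.
have := trig_closure_lin c t1 t0.
by congr trig_closure; apply/funext => x /=; ring.
Qed.

Lemma trig_closureZ c f : trig_closure f -> trig_closure (fun x => c * f x).
Proof.
move=> tf; have := trig_closure_lin c tf (trig_closure_cst 0).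
by congr trig_closure; apply/funext => x /=; ring.
Qed.

Lemma trig_closureD f g : trig_closure f -> trig_closure g ->
  trig_closure (fun x => f x + g x).
Proof.
move=> tf tg; have := trig_closure_lin 1 tf tg.
by congr trig_closure; apply/funext => x /=; ring.
Qed.

(** The product-to-sum formula turns two cosines into cosines of [l' + l] and [l' - l], and nested
    inductions on both factors reduce everything to that case. Limits survive the multiplication
    because the other factor is bounded. *)
Lemma trig_closureM f g : trig_closure f -> trig_closure g ->
  trig_closure (fun x => f x * g x).
Proof.
move=> tf tg; elim: tf => [l a Ll|c h k th hP tk kP|F h M tF FP FM Fh].
- elim: tg => [l' a' Ll'|c h k th hP tk kP|F h M tF FP FM Fh].
  + have t1 := trig_closure_cos (a + a') (Llin 1 Ll Ll').
    have t2 := trig_closure_cos (a' - a) (Llin (-1) Ll Ll').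
    have := trig_closureZ (2^-1) (trig_closureD t1 t2).
    congr trig_closure; apply/funext => x /=.
    have -> : 1 * l x + l' x + (a + a') = (l x + a) + (l' x + a') by ring.
    have -> : -1 * l x + l' x + (a' - a) = (l' x + a') - (l x + a) by ring.
    by rewrite cosD cosB; field.
  + have := trig_closure_lin c hP kP.
    by congr trig_closure; apply/funext => x /=; ring.
  + apply: (@trig_closure_lim _ _ M FP).
      move=> n x; rewrite normrM -[leRHS]mul1r ler_pM// ?ler_norml ?cos_geN1 ?cos_le1//.
    by move=> x; apply: cvgM; [exact: cvg_cst|exact: Fh].
- have := trig_closure_lin c hP kP.
  by congr trig_closure; apply/funext => x /=; ring.
- have [N gN] := trig_closure_bounded tg.
  apply: (@trig_closure_lim _ _ (M * N) FP).
    by move=> n x; rewrite normrM ler_pM.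
  by move=> x; apply: cvgM; [exact: Fh|exact: cvg_cst].
Qed.

Lemma trig_closureX f n : trig_closure f -> trig_closure (fun x => f x ^+ n).
Proof.
move=> tf; elim: n => [|n IHn]; first exact: (trig_closure_cst 1).
have := trig_closureM tf IHn.
by congr trig_closure; apply/funext => x /=; rewrite exprS.
Qed.

Lemma trig_closure_sum (F : nat -> T -> R) n : (forall k, trig_closure (F k)) ->
  trig_closure (fun x => \sum_(0 <= k < n) F k x).
Proof.
move=> tF; elim: n => [|n IHn].
  have := trig_closure_cst 0; congr trig_closure; apply/funext => x /=.
  by rewrite big_geq.
have := trig_closureD IHn (tF n).
by congr trig_closure; apply/funext => x /=; rewrite big_nat_recr.
Qed.

(** The partial sums of the exponential series are polynomials in [f], and [expR M] bounds all of
    them once [M] bounds [f]. *)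
Lemma trig_closure_exp f : trig_closure f -> trig_closure (fun x => expR (f x)).
Proof.
move=> tf; have [M fM] := trig_closure_bounded tf.
apply: (@trig_closure_lim (fun n x => series (exp_coeff (f x)) n) _ (expR M)).
- move=> n; apply: trig_closure_sum => k.
  have := trig_closureZ (k`!%:R^-1) (trig_closureX k tf).
  by congr trig_closure; apply/funext => x /=; rewrite /exp_coeff /= mulrC.
- move=> n x; apply: (@le_trans _ _ (series (exp_coeff M) n)).
    rewrite (le_trans (ler_norm_sum _ _ _))//; apply: ler_sum => k _.
    rewrite /exp_coeff /= normrM normrX (@ger0_norm _ (_^-1))//.
    by rewrite ler_wpM2r// lerXn2r// nnegrE (le_trans _ (fM x)).
  have M0 : 0 <= M by rewrite (le_trans _ (fM x)).
  rewrite /expR; apply: nondecreasing_cvgn_le; last exact: is_cvg_series_exp_coeff.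
  apply: nondecreasing_series => k _ _; exact: exp_coeff_ge0.
- move=> x; rewrite /expR; exact: is_cvg_series_exp_coeff.
Qed.

(* [exp (- n exp (- n s))] tends to 1 if [s > 0] and to 0 if [s <= 0]. *)
Lemma trig_closure_gt0 f : trig_closure f ->
  trig_closure (fun x => (0 < f x)%R%:R).
Proof.
move=> tf.
apply: (@trig_closure_lim (fun n x =>
  expR (- (n.+1%:R * expR (- (n.+1%:R * f x))))) _ 1).
- move=> n; apply: trig_closure_exp.
  have := trig_closureZ (- n.+1%:R) (trig_closure_exp (trig_closureZ (- n.+1%:R) tf)).
  by congr trig_closure; apply/funext => x /=; rewrite !mulNr.
- move=> n x; rewrite ger0_norm ?expR_ge0// -[leRHS]expR0 ler_expR oppr_le0 mulr_ge0 ?expR_ge0.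
- move=> x; case: ltP => [s0|s0] /=.
  + suff : n.+1%:R * expR (- (n.+1%:R * f x)) @[n --> \oo] --> 0.
      move=> /cvgN; rewrite oppr0 => /(continuous_cvg _ (@continuous_expR R 0)).
      by rewrite expR0.
    (* With [y = n.+1%:R * f x], the estimate [y ^+ 2 / 2 <= expR y] bounds [n.+1%:R * expR (- y)]
       by [2 / (n.+1%:R * f x ^+ 2)]. *)
    apply: (@squeeze_cvgr _ _ _ _ (cst 0) (fun n => 2 * (f x ^+ 2)^-1 * n.+1%:R^-1)).
    * apply: nearW => n /=; rewrite mulr_ge0 ?expR_ge0//=.
      have n0 : 0 < n.+1%:R :> R by [].
      have ns0 : 0 <= n.+1%:R * f x by rewrite mulr_ge0 ?ltW.
      have := expR_ge1Dxn 1 ns0; rewrite expRN => h.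
      have {}h : (n.+1%:R * f x) ^+ 2 / 2 <= expR (n.+1%:R * f x).
        by apply: le_trans h; rewrite lerDr.
      rewrite ler_pdivrMr ?expR_gt0//.
      apply: (le_trans _ (ler_wpM2l _ h)); last first.
        by rewrite !mulr_ge0 ?invr_ge0 ?sqr_ge0.
      rewrite le_eqVlt; apply/orP; left; apply/eqP; field.
      by rewrite !gt_eqF.
    * exact: cvg_cst.
    * rewrite -(mulr0 (2 * (f x ^+ 2)^-1)); apply: cvgM; first exact: cvg_cst.
      exact: cvg_harmonic.
  + apply: (@squeeze_cvgr _ _ _ _ (cst 0) (@harmonic R)).
    * apply: nearW => n /=; rewrite expR_ge0 expRN /=.
      rewrite lef_pV2 ?posrE ?expR_gt0// (le_trans _ (expR_ge1Dx _))//.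
      have h : 1 <= expR (- (n.+1%:R * f x)).
        by rewrite -expR0 ler_expR oppr_ge0 mulr_ge0_le0.
      rewrite (le_trans (ler_peMr _ h))// lerDr//.
    * exact: cvg_cst.
    * exact: cvg_harmonic.
Qed.

(** An unbounded [l] is not itself in the closure, since members are bounded. Instead
    [sin ((l - b) / n.+1)], a cosine shifted by a quarter period, is in it, and it has the sign of
    [l - b] as soon as [n.+1] exceeds [|l - b| / pi]; the indicators are therefore eventually
    constant in [n]. *)
Lemma trig_closure_indic_gt l b : L l -> trig_closure (fun x => (b < l x)%R%:R).
Proof.
move=> Ll.
pose s n x := sin (n.+1%:R^-1 * (l x - b)).
apply: (@trig_closure_lim (fun n x => (0 < s n x)%R%:R) _ 1).
- move=> n; apply: trig_closure_gt0.
  have := trig_closure_cos (pi / 2 - n.+1%:R^-1 * b) (Llin (n.+1%:R^-1) Ll L0).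
  move/(trig_closureZ (-1)); congr trig_closure; apply/funext => x /=.
  rewrite (_ : _ + _ = n.+1%:R^-1 * (l x - b) + pi / 2); last by ring.
  by rewrite cosDpihalf mulN1r opprK.
- by move=> n x; case: (_ < _) => /=; rewrite ?normr1 ?normr0.
- move=> x; apply: cvg_near_cst.
  have : (fun n => n.+1%:R^-1 * (l x - b)) @ \oo --> 0 * (l x - b).
    by apply: cvgM; [exact: cvg_harmonic|exact: cvg_cst].
  rewrite mul0r => /cvgr0Pnorm_lt /(_ pi (pi_gt0 R)); apply: filterS => n /= npi.
  rewrite /s -(subr_gt0 b).
  have n0 : 0 < n.+1%:R^-1 :> R by rewrite invr_gt0.
  case: (ltP 0 (l x - b)) => [lb|lb].
    rewrite sin_gt0_pi// mulr_gt0//=.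
    by move: npi; rewrite gtr0_norm// mulr_gt0.
  apply/eqP; rewrite eqr_nat eqb0 -leNgt -oppr_ge0 -sinN sin_ge0_pi//.
  rewrite oppr_ge0 mulr_ge0_le0 ?(ltW n0)//=.
  by move: npi; rewrite ler0_norm ?mulr_ge0_le0 ?(ltW n0)// => /ltW.
Qed.
End TrigClosure.

(** * Probability measures determined by their cosine integrals *)

Lemma integrable_bounded d (T : measurableType d) (R : realType)
    (P : probability T R) (f : T -> R) (M : R) :
  measurable_fun setT f -> (forall x, `|f x| <= M) ->
  P.-integrable setT (EFin \o f).
Proof.
move=> mf fM; apply: measurable_bounded_integrable => //.
  exact: le_lt_trans (probability_le1 P measurableT) (ltry _).
by exists M; split; rewrite ?num_real// => y My x _ /=; rewrite (le_trans (fM x)) ?ltW.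
Qed.

Lemma bounded_Rintegral_cvg d (T : measurableType d) (R : realType)
    (P : probability T R) (F : nat -> T -> R) (f : T -> R) (M : R) :
  (forall n, measurable_fun setT (F n)) -> (forall n x, `|F n x| <= M) ->
  (forall x, F n x @[n --> \oo] --> f x) ->
  \int[P]_x F n x @[n --> \oo] --> \int[P]_x f x.
Proof.
move=> mF FM Ff.
have mf : measurable_fun setT f.
  by apply: (measurable_fun_cvg mF) => x _; exact: Ff.
have fM x : `|f x| <= M.
  apply: (@closed_cvg _ _ \oo _ (fun n => `|F n x|) [set y | y <= M]).
  - exact: closed_le.
  - by apply: nearW => n; exact: FM.
  - by apply: cvg_norm; exact: Ff.
rewrite /Rintegral; apply: fine_cvg; rewrite fineK; last first.
  by apply: integrable_fin_num => //; exact: (integrable_bounded _ mf fM).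
apply: (@dominated_cvg _ _ _ P _ _ (fun n => EFin \o F n) _ (EFin \o cst M)) => //.
- by move=> n; exact/measurable_EFinP.
- by move=> x _; apply/cvg_EFin; [exact: nearW|exact: Ff].
- by apply: (@integrable_bounded _ _ _ _ _ `|M|).
- by move=> n x _; rewrite lee_fin.
Qed.

Section TrigUnique.
Context d (T : measurableType d) (R : realType) (P Q : probability T R).
Variable L : set (T -> R).
Hypothesis L0 : L (cst 0).
Hypothesis Llin : forall (c : R) l l', L l -> L l' -> L (fun x => c * l x + l' x).
Hypothesis mL : forall l, L l -> measurable_fun setT l.
Hypothesis PQcos : forall l a, L l ->
  \int[P]_x cos (l x + a) = \int[Q]_x cos (l x + a).

Lemma measurable_trig_closure f : trig_closure L f -> measurable_fun setT f.
Proof.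
elim=> [l a Ll|c g h _ mg _ mh|F g M _ mF _ Fg].
- apply: measurableT_comp; first exact: continuous_measurable_fun (@continuous_cos R).
  by apply: measurable_funD => //; exact: mL.
- by apply: measurable_funD => //; apply: measurable_funM.
- by apply: (measurable_fun_cvg mF) => x _; exact: Fg.
Qed.

Lemma trig_closure_Rintegral f : trig_closure L f ->
  \int[P]_x f x = \int[Q]_x f x.
Proof.
elim=> [l a Ll|c g h tg PQg th PQh|F g M tF PQF FM Fg].
- exact: PQcos.
- have [M gM] := trig_closure_bounded tg; have [N hN] := trig_closure_bounded th.
  have mg := measurable_trig_closure tg; have mh := measurable_trig_closure th.
  have E (S : probability T R) :
      \int[S]_x (c * g x + h x) = c * \int[S]_x g x + \int[S]_x h x.
    have ig : S.-integrable setT (EFin \o g) by exact: integrable_bounded gM.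
    rewrite RintegralD//.
    + by rewrite RintegralZl.
    + apply: (@integrable_bounded _ _ _ _ _ (`|c| * M)).
        exact: measurable_funM.
      by move=> x; rewrite normrM ler_wpM2l.
    + exact: integrable_bounded hN.
  by rewrite !E PQg PQh.
- have mF n := measurable_trig_closure (tF n).
  have hP := bounded_Rintegral_cvg (P := P) mF FM Fg.
  have hQ := bounded_Rintegral_cvg (P := Q) mF FM Fg.
  rewrite -(cvg_lim (@Rhausdorff R) hP) -(cvg_lim (@Rhausdorff R) hQ).
  by congr (lim (_ @ \oo)); apply/funext.
Qed.

(** Measurable sets whose indicator lies in the closure form a pi-system, because the closure is
    stable under products. Both measures agree on it, and it contains the generating half-spaces. *)
Lemma trig_measure_unique :
  measurable `<=` <<s [set A | exists l b, L l /\ A = [set x | b < l x] ] >> ->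
  forall A, measurable A -> P A = Q A.
Proof.
move=> gen A mA.
pose G : set (set T) := [set A | measurable A /\
  trig_closure L (fun x => (x \in A)%:R)].
apply: (g_sigma_algebra_measure_unique G _ (fun=> setT)).
- by move=> X [].
- move=> _; split=> //; have := trig_closure_cst L0 1.
  by congr trig_closure; apply/funext => x; rewrite in_setT.
- by rewrite bigcup_const.
- move=> X Y [mX tX] [mY tY]; split; first exact: measurableI.
  have := trig_closureM L0 Llin tX tY.
  by congr trig_closure; apply/funext => x /=; rewrite in_setI -natrM mulnb.
- move=> X [mX /trig_closure_Rintegral].
  have E (S : probability T R) : \int[S]_x (x \in X)%:R = fine (S X).
    by rewrite -[S X](_ : (\int[S]_x (\1_X x)%:E)%E = _) // integral_indic// setIT.
  have fin_inj (a b : \bar R) : a \is a fin_num -> b \is a fin_num ->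
      fine a = fine b -> a = b by case: a b => [a||] [b||] //= _ _ ->.
  by rewrite !E => /fin_inj; apply; exact: fin_num_measure.
- by move=> _; exact: le_lt_trans (probability_le1 P measurableT) (ltry _).
move: (gen _ mA); apply: sub_sigma_algebra2 => _ [l [b [Ll ->]]]; split.
  rewrite (_ : [set x | _] = setT `&` l @^-1` `]b, +oo[).
    by apply: mL.
  by rewrite setTI; apply/seteqP; split=> x /=; rewrite in_itv /= andbT.
have := trig_closure_indic_gt L0 Llin b Ll.
by congr trig_closure; apply/funext => x; congr (nat_of_bool _)%:R; apply/idP/idP; rewrite inE.
Qed.
End TrigUnique.

(** * Hahn-Banach *)

Lemma scalar_functional (R : realType) (V : lmodType R) (q : V -> R) :
  linear_for *%R q -> exists phi : {scalar V}, (phi : V -> R) = q.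
Proof.
move=> qL.
by exists (HB.pack_for {scalar V} q (GRing.isLinear.Build R V R *%R q qL)).
Qed.

Section HahnBanach.
Context (R : realType) (V : lmodType R).

(** Homogeneity is asked as an inequality only, the form that passes directly to infima; applying it
    to the inverse scalar recovers equality. *)
Definition sublinear (q : V -> R) :=
  (forall x y, q (x + y) <= q x + q y) /\
  (forall t x, 0 < t -> q (t *: x) <= t * q x).

Lemma sublinearZ q t x : sublinear q -> 0 <= t -> q (t *: x) = t * q x.
Proof.
move=> [_ qZ]; rewrite le_eqVlt => /predU1P[<-|t0].
  rewrite scale0r mul0r; apply/eqP.
  have h2 : 0 <= q 0.
    by have := qZ 2 0 (ltr0n _ 2); rewrite scaler0 mulr_natl mulr2n -subr_ge0 addrK.
  have h : q 0 <= 2^-1 * q 0.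
    by have := qZ 2^-1 0; rewrite scaler0; apply; rewrite invr_gt0.
  by rewrite eq_le h2 andbT; lra.
apply/eqP; rewrite eq_le qZ//= -ler_pdivlMl//.
have := qZ t^-1 (t *: x); rewrite scalerA mulVf ?gt_eqF// scale1r; apply.
by rewrite invr_gt0.
Qed.

Lemma sublinear_ge q x : sublinear q -> - q (- x) <= q x.
Proof.
move=> sq; have := sq.1 x (- x); rewrite subrr.
have := @sublinearZ q 0 0 sq (lexx 0); rewrite scale0r mul0r => ->.
by lra.
Qed.

(* This shift lies below [q] and takes the value [- q y] or less at [- y]. *)
Definition sublinear_shift (q : V -> R) y x :=
  inf [set q (x + t *: y) - t * q y | t in [set t | 0 <= t] ].

Lemma sublinear_shift_le q y x t : sublinear q -> 0 <= t ->
  sublinear_shift q y x <= q (x + t *: y) - t * q y.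
Proof.
move=> sq t0; apply: ge_inf; last by exists t.
exists (- q (- x)) => _ [s s0 <-].
have := sq.1 (- x) (x + s *: y); rewrite addKr sublinearZ//; lra.
Qed.

Lemma le_sublinear_shift q y x m :
  (forall t, 0 <= t -> m <= q (x + t *: y) - t * q y) ->
  m <= sublinear_shift q y x.
Proof.
move=> h; apply: lb_le_inf => [|_ [t t0 <-]]; last exact: h.
by exists (q (x + 0 *: y) - 0 * q y); exists 0 => /=.
Qed.

Lemma sublinear_shift_sublinear q y : sublinear q ->
  sublinear (sublinear_shift q y).
Proof.
move=> sq; split=> [x x'|s x s0].
- rewrite -lerBlDr; apply: le_sublinear_shift => t t0.
  rewrite lerBlDl -lerBlDr; apply: le_sublinear_shift => t' t'0.
  rewrite lerBlDr.
  have := sublinear_shift_le y (x + x') sq (addr_ge0 t0 t'0).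
  have := sq.1 (x + t *: y) (x' + t' *: y).
  rewrite scalerDl addrACA; lra.
- rewrite -ler_pdivrMl//; apply: le_sublinear_shift => t t0.
  rewrite ler_pdivrMl//.
  have := sublinear_shift_le y (s *: x) sq (mulr_ge0 (ltW s0) t0).
  by rewrite -scalerA -scalerDr (sublinearZ (x + t *: y) sq) ?(ltW s0)// mulrBr mulrA.
Qed.

(* A minimal sublinear functional is linear, since it cannot lie strictly above
   any of its shifts. *)
Lemma hahn_banach p : sublinear p ->
  exists f : {scalar V}, forall x, f x <= p x.
Proof.
move=> sp.
pose S := {q : V -> R | sublinear q /\ forall x, q x <= p x}.
(* The order is reversed, so that a maximal element for Zorn's lemma is a pointwise minimal
   functional. *)
pose below (q q' : S) := `[< forall x, sval q' x <= sval q x >].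
have [||||q qmin] := @Zorn S below.
- by move=> q; apply/asboolP.
- move=> q1 q2 q3 /asboolP h1 /asboolP h2; apply/asboolP => x.
  exact: le_trans (h2 x) (h1 x).
- move=> [q1 h1] [q2 h2] /asboolP /= h12 /asboolP /= h21.
  apply: eq_exist; apply/funext => x; apply/eqP.
  by rewrite eq_le h21 h12.
- move=> A totA.
  have [[q0 Aq0]|nA] := pselect (exists q, A q); last first.
    by exists (exist _ p (conj sp (fun x => lexx (p x)))) => s As; case: nA; exists s.
  (* The bound of a nonempty chain is its pointwise infimum, which is finite because each member is
     at least [- p (- x)] at [x]. *)
  pose m x := inf [set sval q x | q in A].
  have m_le q x : A q -> m x <= sval q x.
    move=> Aq; apply: ge_inf; last by exists q.
    exists (- p (- x)) => _ [r Ar <-].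
    have [sr rp] := svalP r.
    by rewrite (le_trans _ (sublinear_ge x sr))// lerN2.
  have le_m x c : (forall q, A q -> c <= sval q x) -> c <= m x.
    move=> h; apply: lb_le_inf => [|_ [q Aq <-]]; last exact: h.
    by exists (sval q0 x); exists q0.
  have sm : sublinear m.
    split=> [x y|t x t0].
    + rewrite -lerBlDr; apply: (le_m) => q Aq.
      rewrite lerBlDl -lerBlDr; apply: (le_m) => q' Aq'; rewrite lerBlDr.
      (* Of two members of the chain, the smaller one serves for both [x] and [y]. *)
      have [/asboolP h|/asboolP h] := totA _ _ Aq Aq'.
      * have := m_le _ (x + y) Aq'; have := (svalP q').1.1 x y; have := h x; lra.
      * have := m_le _ (x + y) Aq; have := (svalP q).1.1 x y; have := h y; lra.
    + rewrite -ler_pdivrMl//; apply: (le_m) => q Aq; rewrite ler_pdivrMl//.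
      by rewrite (le_trans (m_le _ _ Aq))//; exact: (svalP q).1.2.
  have mp x : m x <= p x by rewrite (le_trans (m_le _ _ Aq0))//; exact: (svalP q0).2.
  exists (exist _ m (conj sm mp)) => s As; apply/asboolP => x /=; exact: m_le.
case: q qmin => q [sq qp] qmin.
have shift_le y x : sublinear_shift q y x <= q x.
  by have := sublinear_shift_le y x sq (lexx 0); rewrite scale0r addr0 mul0r subr0.
have shiftE y : sublinear_shift q y = q.
  have sy : sublinear (sublinear_shift q y) /\ forall x, sublinear_shift q y x <= p x.
    by split=> [|x]; [exact: sublinear_shift_sublinear|exact: le_trans (qp x)].
  have e : below (exist _ q (conj sq qp)) (exist _ _ sy) by apply/asboolP => x /=.
  exact: (congr1 (fun s : S => sval s) (qmin _ e)).
(* Since [q] equals its shift by [y], the value at [t = 1] gives [q x <= q (x + y) - q y], which is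
   superadditivity. *)
have qD x y : q (x + y) = q x + q y.
  apply/eqP; rewrite eq_le sq.1/=.
  have := sublinear_shift_le y x sq ler01; rewrite shiftE scale1r mul1r; lra.
have qN x : q (- x) = - q x.
  have := qD x (- x); rewrite subrr.
  have := @sublinearZ q 0 0 sq (lexx 0); rewrite scale0r mul0r => ->; lra.
have qL : linear_for *%R q.
  move=> a x y; rewrite qD; congr (_ + _).
  have [a0|a0] := leP 0 a; first exact: sublinearZ.
  rewrite -[in LHS](opprK a) scaleNr qN sublinearZ ?oppr_ge0 ?(ltW a0)//; ring.
by have [f fq] := scalar_functional qL; exists f; rewrite fq.
Qed.
End HahnBanach.

(** Hahn-Banach is applied to the shift of the norm by [x] rather than to the norm. That shift lies
    below the norm and is at most [- |x|] at [- x], which forces [f x >= |x|]; no extension from the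
    line through [x] is involved. *)
Lemma normed_functional (R : realType) (B : normedModType R) (x : B) :
  exists f : {scalar B},
    [/\ continuous (f : B -> R), f x = `|x| & forall y, `|f y| <= `|y|].
Proof.
have sn : sublinear (fun y : B => `|y|).
  by split=> [y z|t y t0]; [exact: ler_normD|rewrite normrZ gtr0_norm].
have [f fp] := hahn_banach (sublinear_shift_sublinear x sn).
have fle y : f y <= `|y|.
  rewrite (le_trans (fp y))//.
  by have := sublinear_shift_le x y sn (lexx 0); rewrite scale0r addr0 mul0r subr0.
have fN y : `|f y| <= `|y|.
  by rewrite ler_norml fle andbT lerNl -linearN -(normrN y) fle.
exists f; split=> //.
  move=> y; apply/cvgrPdist_le => e e0.
  apply: filterS (nbhsx_ballx y e e0) => z; rewrite -ball_normE /= => yz.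
  by rewrite -linearB (le_trans (fN _))// ltW.
apply/eqP; rewrite eq_le fle/= -lerN2 -linearN (le_trans (fp _))//.
have := sublinear_shift_le x (- x) sn ler01.
by rewrite scale1r mul1r addNr normr0 sub0r.
Qed.

(** * Separability, and the Borel sets generated by functionals *)

Definition dense_seq (R : realType) (V : normedModType R) (g : nat -> V) :=
  forall x e, 0 < e -> exists n, `|x - g n| < e.

Lemma separable_dense_seq (R : realType) (V : normedModType R) :
  (exists2 D : set V, countable D & dense D) -> exists g : nat -> V, dense_seq g.
Proof.
move=> [D /pcard_surjP[g gD] dD]; exists g => x e e0.
have [||y [xy Dy]] := dD (ball x e).
- by exists x; exact: ballxx.
- exact: ball_open.
have [n _ gn] := gD _ Dy; exists n.
by move: xy; rewrite -ball_normE /= gn.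
Qed.

Lemma dense_seq_image (R : realType) (V W : normedModType R) (h : V -> W)
    (g : nat -> V) :
  continuous h -> dense (range h) -> dense_seq g -> dense_seq (h \o g).
Proof.
move=> ch dh dg x e e0.
have [||y [xy [v _ vy]]] := dh (ball x (e / 2)).
- by exists x; apply: ballxx; rewrite divr_gt0.
- by apply: ball_open; rewrite divr_gt0.
move: xy; rewrite -vy -ball_normE /= => xy.
have e20 : 0 < e / 2 by rewrite divr_gt0.
have /cvgrPdist_lt /(_ _ e20) /nbhs_ballP [r /= r0 hr] := ch v.
have [n vn] := dg v r r0; exists n.
rewrite [ltRHS]splitr -(subrKA (h v)) (le_lt_trans (ler_normD _ _))// ltrD//.
by apply: hr; rewrite -ball_normE.
Qed.

Definition continuous_functional (R : realType) (B : normedModType R) :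
  set (B -> R) := [set l : B -> R | exists2 xs : {scalar B}, continuous (xs : B -> R) & l = xs :> (B -> R)].

Section BorelFunctionals.
Context (R : realType) (B : completeNormedModType R) (g : nat -> B).
Hypothesis dg : dense_seq g.

Let gen : set (set B) :=
  [set A | exists l b, continuous_functional l /\ A = [set x | b < l x] ].

(** Norming functionals [f n] of the dense points make the norm a countable supremum. A closed ball
    is then the complement of a countable union of half-spaces, and an open set is a countable union
    of closed balls with centres in the sequence and radii [m.+1%:R^-1]. *)
Lemma borel_functionals : @measurable _ (borel B) `<=` <<s gen >>.
Proof.
have [f fP] := choice (fun n => normed_functional (g n)).
have norm_gt z e : e < `|z| <-> exists n, e < f n z.
  split=> [ez|[n]]; last first.
    by have [_ _ fn] := fP n; move=> /lt_le_trans; apply; rewrite (le_trans (ler_norm _)).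
  (* Within half the gap, [f n z >= |g n| - |z - g n| >= |z| - 2 * |z - g n| > e]. *)
  have ze0 : 0 < (`|z| - e) / 2 by rewrite divr_gt0// subr_gt0.
  have [n zn] := dg z ze0; exists n; have [_ fn fle] := fP n.
  have h1 : `|g n| - f n z <= `|z - g n|.
    by rewrite -fn -linearB distrC (le_trans (ler_norm _)).
  have h3 : `|z| <= `|g n| + `|z - g n|.
    by rewrite -[in leLHS](subrK (g n) z) addrC ler_normD.
  by move: zn h1 h3; rewrite ltr_pdivlMr//; lra.
have mball d e : <<s gen >> [set x | `|x - d| <= e].
  rewrite (_ : [set x | _] = ~` \bigcup_n [set x | e + f n d < f n x]); last first.
    apply/seteqP; split=> x /=.
      move=> xd [n _ /= h]; suff : e < `|x - d| by rewrite ltNge xd.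
      by apply/norm_gt; exists n; rewrite linearB ltrBrDr.
    move=> h; rewrite leNgt; apply/negP => /norm_gt[n xn]; apply: h; exists n => //=.
    by rewrite -ltrBrDr -linearB.
  apply: (@measurableC _ (g_sigma_algebraType gen)).
  apply: bigcupT_measurable => n; apply: sub_sigma_algebra.
  exists (f n), (e + f n d); split=> //.
  by exists (f n) => //; have [] := fP n.
apply: smallest_sub; first exact: smallest_sigma_algebra.
move=> U oU.
pose K := [set p : nat * nat | [set x | `|x - g p.1| <= p.2.+1%:R^-1] `<=` U].
rewrite (_ : U = \bigcup_(p in K) [set x | `|x - g p.1| <= p.2.+1%:R^-1]).
  rewrite bigcup_mkcond; apply: (@countable_bigcupT_measurable _ (g_sigma_algebraType gen)).
    exact: countableP.
  by move=> p; case: ifPn => _; [exact: mball|exact: measurable0].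
apply/seteqP; split=> x; last by move=> [p Kp] /Kp.
move=> Ux; have /nbhs_ballP[r /= r0 rU] : nbhs x U by exact: open_nbhs_nbhs.
have [m] := ltr_add_invr (divr_gt0 r0 (ltr0n R 2)).
rewrite add0r => mr.
have m0 : 0 < m.+1%:R^-1 :> R by rewrite invr_gt0.
have [n xn] := dg x m0.
exists (n, m); last exact: ltW.
move=> y /= yn; apply: rU; rewrite -ball_normE /=.
rewrite -(subrKA (g n)) (le_lt_trans (ler_normD _ _))// (splitr r) ltrD//.
  exact: lt_trans xn mr.
by rewrite distrC (le_lt_trans yn).
Qed.
End BorelFunctionals.

(** * Hilbert geometry *)

Section HilbertGeometry.
Context (R : realType) (H : completeNormedModType R) (ip : {dot H for idfun}).
Hypothesis norm_ip : forall h : H, `|h| ^+ 2 = ip h h.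

Lemma ipC u v : ip u v = ip v u.
Proof. by rewrite hermC expr0 mul1r. Qed.

Lemma ipDr u v w : ip u (v + w) = ip u v + ip u w.
Proof. exact: linearDr. Qed.

Lemma ipZr u a v : ip u (a *: v) = a * ip u v.
Proof. exact: linearZr_LR. Qed.

Lemma ipDl u v w : ip (u + v) w = ip u w + ip v w.
Proof. by rewrite !(ipC _ w) ipDr. Qed.

Lemma ipZl a u v : ip (a *: u) v = a * ip u v.
Proof. by rewrite !(ipC _ v) ipZr. Qed.

Lemma ip0r u : ip u 0 = 0.
Proof. by rewrite -(scale0r 0) ipZr mul0r. Qed.

Lemma ip0l u : ip 0 u = 0.
Proof. by rewrite ipC ip0r. Qed.

Lemma ipNr u v : ip u (- v) = - ip u v.
Proof. by rewrite -scaleN1r ipZr mulN1r. Qed.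

Lemma ipNl u v : ip (- u) v = - ip u v.
Proof. by rewrite ipC ipNr ipC. Qed.

Lemma ipBr u v w : ip u (v - w) = ip u v - ip u w.
Proof. by rewrite ipDr ipNr. Qed.

Lemma ipBl u v w : ip (u - v) w = ip u w - ip v w.
Proof. by rewrite ipDl ipNl. Qed.

Lemma ip_sumr u n (c : 'I_n -> H) : ip u (\sum_i c i) = \sum_i ip u (c i).
Proof.
elim/big_ind2: _ => [|x y z t <- <-|//]; first exact: ip0r.
by rewrite ipDr.
Qed.

Lemma ip_suml u n (c : 'I_n -> H) : ip (\sum_i c i) u = \sum_i ip (c i) u.
Proof. by rewrite ipC ip_sumr; apply: eq_bigr => i _; rewrite ipC. Qed.

Lemma ip_eq0 u : ip u u = 0 -> u = 0.
Proof. by rewrite -norm_ip => /eqP; rewrite sqrf_eq0 normr_eq0 => /eqP. Qed.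

Lemma sqr_normD u v : `|u + v| ^+ 2 = `|u| ^+ 2 + 2 * ip u v + `|v| ^+ 2.
Proof. by rewrite !norm_ip ipDl !ipDr (ipC v u); ring. Qed.

Lemma sqr_normB u v : `|u - v| ^+ 2 = `|u| ^+ 2 - 2 * ip u v + `|v| ^+ 2.
Proof. by rewrite sqr_normD ipNr normrN; ring. Qed.

Lemma cauchy_schwarz u v : `|ip u v| <= `|u| * `|v|.
Proof.
have [->|v0] := eqVneq v 0; first by rewrite ip0r !normr0 mulr0.
rewrite -(@ler_pXn2r _ 2)// ?nnegrE ?mulr_ge0// exprMn real_normK ?num_real//.
have v20 : 0 < `|v| ^+ 2 by rewrite exprn_gt0// normr_gt0.
have := sqr_ge0 `|u - (ip u v / `|v| ^+ 2) *: v|.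
rewrite sqr_normB ipZr normrZ exprMn (@real_normK _ (_ / _)) ?num_real//.
move=> /(ler_wpM2r (ltW v20)); rewrite mul0r.
have -> : (`|u| ^+ 2 - 2 * (ip u v / `|v| ^+ 2 * ip u v) +
   (ip u v / `|v| ^+ 2) ^+ 2 * `|v| ^+ 2) * `|v| ^+ 2 =
   `|u| ^+ 2 * `|v| ^+ 2 - ip u v ^+ 2 by field; rewrite normr_eq0.
by rewrite subr_ge0.
Qed.

Lemma ip_continuous h : continuous (ip h).
Proof.
move=> x; apply/cvgrPdist_le => e e0.
have h0 : 0 < `|h| + 1 by rewrite ltr_wpDl.
have /filterS := nbhsx_ballx x (e / (`|h| + 1)) (divr_gt0 e0 h0); apply => y.
rewrite -ball_normE /= ltr_pdivlMr// => xy.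
rewrite -ipBr (le_trans (cauchy_schwarz _ _))// ltW// (le_lt_trans _ xy)//.
by rewrite mulrC ler_wpM2l// lerDl.
Qed.

Lemma closest_point_orthogonal (w s : H) :
  (forall t : R, `|w| <= `|w - t *: s|) -> ip s w = 0.
Proof.
move=> wmin; pose c := ip s w; pose q := `|s| ^+ 2.
have q0 : 0 <= q by exact: sqr_ge0.
(* Dividing by [q + 1] in place of the optimal [q] avoids a separate case [s = 0]. Clearing
   denominators leaves [- (c ^+ 2 * (q + 2))], still negative unless [c = 0]. *)
have := wmin (c / (q + 1)); rewrite -(@ler_pXn2r _ 2)// ?nnegrE// sqr_normB.
rewrite ipZr (ipC w s) -/c normrZ exprMn -/q real_normK ?num_real// => h.
have {}h : 0 <= (- 2 * (c / (q + 1) * c) + (c / (q + 1)) ^+ 2 * q) * (q + 1) ^+ 2.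
  by rewrite mulr_ge0 ?sqr_ge0//; lra.
have q1 : q + 1 != 0 by rewrite gt_eqF// ltr_wpDl.
have : 0 <= - (c ^+ 2 * (q + 2)).
  by apply: le_trans h _; rewrite le_eqVlt; apply/orP; left; apply/eqP; field.
rewrite oppr_ge0 => h2; apply/eqP; rewrite -sqrf_eq0 eq_le sqr_ge0 andbT -/c.
by rewrite -(pmulr_lle0 _ (_ : 0 < q + 2))// ?ltr_wpDl// mulrC.
Qed.

(** The foot point is sought in the closure because [S] need not be closed. One statement then
    covers the closed space [Q], the kernel of a functional, and the space of Riesz vectors, whose
    density is still to be shown. *)
Lemma projection_closure (S : set H) (h : H) :
  S 0 -> (forall (a : R) x y, S x -> S y -> S (a *: x + y)) ->
  exists2 m, closure S m & forall s, S s -> ip s (h - m) = 0.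
Proof.
move=> S0 Slin.
pose d := inf [set `|h - s| | s in S].
have dlb s : S s -> d <= `|h - s|.
  by move=> Ss; apply: ge_inf; [exists 0 => _ [r _ <-]|exists s].
have /choice[s sP] n : exists x, S x /\ `|h - x| < d + n.+1%:R^-1.
  have hi : has_inf [set `|h - s| | s in S].
    by split; [exists `|h - 0|; exists 0|exists 0 => _ [r _ <-]].
  have n0 : 0 < n.+1%:R^-1 :> R by rewrite invr_gt0.
  by have [_ [x Sx <-] hx] := inf_adherent n0 hi; exists x.
have d0 : 0 <= d by apply: lb_le_inf; [exists `|h - 0|; exists 0|move=> _ [r _ <-]].
have cs : cvg (s @ \oo).
  apply: cauchy_cvg; apply: cauchy_exP => e e0.
  (* By the parallelogram law [|s N - s n| ^+ 2 <= 4 * (d + eps) ^+ 2 - 4 * d ^+ 2], where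
     [eps = N.+1%:R^-1]; as [eps <= 1], this is at most [4 * (2 * d + 1) * eps]. *)
  have c0 : 0 < 4 * (2 * d + 1) by lra.
  have [N NE] := ltr_add_invr (divr_gt0 (exprn_gt0 2 e0) c0).
  rewrite add0r in NE.
  exists (s N); exists N => // n /= Nn; rewrite -ball_normE /=.
  have nN : n.+1%:R^-1 <= N.+1%:R^-1 :> R.
    by rewrite lef_pV2 ?posrE// ler_nat ltnS.
  rewrite -(@ltr_pXn2r _ 2)// ?nnegrE ?(ltW e0)//.
  have mid := dlb _ (Slin 2^-1 _ _ (Slin 1 _ _ (sP n).1 (sP N).1) S0).
  have a := (sP n).2; have b := (sP N).2.
  have an := dlb _ (sP n).1; have bn := dlb _ (sP N).1.
  have E : `|s N - s n| ^+ 2 = 2 * `|h - s n| ^+ 2 + 2 * `|h - s N| ^+ 2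
      - 4 * `|h - (2^-1 *: (1 *: s n + s N) + 0)| ^+ 2.
    have -> : s N - s n = (h - s n) - (h - s N) by rewrite opprB [RHS]addrC subrKA.
    have -> : h - (2^-1 *: (1 *: s n + s N) + 0) = 2^-1 *: ((h - s n) + (h - s N)).
      rewrite addr0 scale1r !scalerDr addrACA -scalerDl.
      by rewrite (_ : 2^-1 + 2^-1 = 1) ?scale1r ?scalerN ?opprD//; field.
    by rewrite normrZ exprMn (sqr_normB (h - s n)) (sqr_normD (h - s n)) (@ger0_norm _ 2^-1)//; field.
  rewrite E; set A := `|h - s n| in a an *; set B := `|h - s N| in b bn *.
  set C := `|_| in mid *; set eps := N.+1%:R^-1 in NE nN b.
  have eps1 : eps <= 1 by rewrite invf_le1// ler1n.
  have eps0 : 0 < eps by rewrite invr_gt0.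
  have {}a : A < d + eps by apply: lt_le_trans a _; rewrite lerD2l.
  clearbody A B C eps.
  have A2 : A ^+ 2 <= (d + eps) ^+ 2 by rewrite ler_pXn2r// ?nnegrE; lra.
  have B2 : B ^+ 2 <= (d + eps) ^+ 2 by rewrite ler_pXn2r// ?nnegrE; lra.
  have C2 : d ^+ 2 <= C ^+ 2 by rewrite ler_pXn2r// ?nnegrE; lra.
  move: NE; rewrite ltr_pdivlMr// => NE.
  have : eps ^+ 2 <= eps by rewrite expr2 ger_pMl.
  move: A2 B2 NE; rewrite sqrrD; lra.
exists (lim (s @ \oo)).
  apply: (@closed_cvg _ _ \oo _ s (closure S)) => //.
  - exact: closed_closure.
  - by apply: nearW => n; apply: subset_closure; exact: (sP n).1.
move=> x Sx; apply: closest_point_orthogonal => t.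
apply: (@le_trans _ _ d).
  have h1 : `|h - s n| @[n --> \oo] --> `|h - lim (s @ \oo)|.
    by apply: cvg_norm; apply: cvgB => //; exact: cvg_cst.
  have h2 : d + n.+1%:R^-1 @[n --> \oo] --> d + 0.
    by apply: cvgD; [exact: cvg_cst|exact: cvg_harmonic].
  rewrite -[leRHS]addr0; apply: ler_cvg_to h1 h2 _.
  by apply: nearW => n; rewrite ltW// (sP n).2.
have h1 : `|h - s n - t *: x| @[n --> \oo] --> `|h - lim (s @ \oo) - t *: x|.
  apply: cvg_norm; apply: cvgB; last exact: cvg_cst.
  by apply: cvgB => //; exact: cvg_cst.
apply: (@closed_cvg _ _ \oo _ _ [set y | d <= y] _ _ _ h1).
- exact: closed_ge.
- by apply: nearW => n /=; rewrite -addrA -opprD dlb// addrC; apply: Slin => //; exact: (sP n).1.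
Qed.

Lemma riesz (phi : {scalar H}) : continuous (phi : H -> R) ->
  exists r, forall k, ip r k = phi k.
Proof.
move=> cphi.
have [phi0|/existsNP[h /eqP phih]] := pselect (forall k, phi k = 0).
  by exists 0 => k; rewrite phi0 ip0l.
have [|a x y /= px py|m] := @projection_closure [set k | phi k = 0] h.
- exact: linear0.
- by rewrite linearP px py mulr0 addr0.
move=> Sm orth.
have phim : phi m = 0.
  suff : closed [set k | phi k = 0] by move=> /closure_id clE; move: Sm; rewrite -clE.
  by apply: (@preimage_closed _ _ phi [set 0]); [move=> x _; exact: cphi|exact: closed_eq].
pose w := h - m; have phiw : phi w != 0 by rewrite linearB phim subr0.
have w0 : `|w| ^+ 2 != 0.
  by rewrite sqrf_eq0 normr_eq0; apply: contra_neq phiw => ->; rewrite linear0.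
exists ((phi w / `|w| ^+ 2) *: w) => k.
have : ip (k - (phi k / phi w) *: w) w = 0.
  by apply: orth => /=; rewrite linearB linearZ /= divfK// subrr.
rewrite ipBl !ipZl -norm_ip ipC => /eqP; rewrite subr_eq0 => /eqP ->.
by field; rewrite phiw -sqrf_eq0 w0.
Qed.
End HilbertGeometry.

Section OrthogonalDecomposition.
Context (R : realType) (H : completeNormedModType R) (ip : {dot H for idfun}).
Hypothesis norm_ip : forall h : H, `|h| ^+ 2 = ip h h.
Variable Q : set H.
Hypothesis closed_Q : closed_subspace Q.
Variables (n : nat) (e : 'I_n -> H).
Hypothesis he : orthonormal_basis ip (orthogonal_complement ip Q) e.
Local Notation M := (orthogonal_complement ip Q).

Lemma orthonormal_coord (c : 'I_n -> R) i : ip (e i) (\sum_k c k *: e k) = c i.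
Proof.
rewrite ip_sumr (bigD1 i)//= ipZr he.1 eqxx mulr1 big1 ?addr0// => k ki.
by rewrite ipZr he.1 eq_sym (negbTE ki) mulr0.
Qed.

Lemma orthonormal_expansion p : M p -> p = \sum_i ip (e i) p *: e i.
Proof.
rewrite he.2 => -[c _ <-]; apply: eq_bigr => i _; congr (_ *: _).
by rewrite orthonormal_coord.
Qed.

Lemma orthogonal_complement_basis i : M (e i).
Proof.
rewrite he.2; exists (fun k => (k == i)%:R) => //.
rewrite (bigD1 i)//= eqxx scale1r big1 ?addr0// => k /negbTE ->.
by rewrite scale0r.
Qed.

Lemma orthogonal_complement_lin (a : R) x y : M x -> M y -> M (a *: x + y).
Proof.
by move=> Mx My q Qq; rewrite ipDr ipZr Mx// My// mulr0 addr0.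
Qed.

Lemma orthogonal_projectionE h m : Q m -> M (h - m) ->
  orthogonal_projection ip Q h = m.
Proof.
move=> Qm Mm; apply: xget_unique => // m' [Qm' Mm'].
apply/eqP; rewrite -subr_eq0; apply/eqP; apply: (ip_eq0 norm_ip).
have [_ _ Qlin] := closed_Q.
have Qd : Q (m' - m) by rewrite -scaleN1r addrC; exact: Qlin.
have -> : ip (m' - m) (m' - m) = ip (m' - m) (h - m) - ip (m' - m) (h - m').
  by rewrite -ipBr; congr (ip _ _); rewrite opprB [RHS]addrC subrKA.
by rewrite Mm// Mm'// subrr.
Qed.

(** As [Q] is closed, [projection_closure] supplies a foot point [m] in [Q], so the choice made by
    [orthogonal_projection] is meaningful. The remainder [h - m] expands in the finite basis, with
    the coordinates of [h] because each [e i] is orthogonal to [m]. *)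
Lemma sum_projectionE h : orthogonal_projection ip Q h =
  h - \sum_i ip (e i) h *: e i.
Proof.
have [cQ Q0 Qlin] := closed_Q.
have [m] := projection_closure norm_ip h Q0 Qlin.
move: cQ => /closure_id <- Qm hm.
rewrite (orthogonal_projectionE Qm hm).
suff -> : \sum_i ip (e i) h *: e i = h - m by rewrite subKr.
rewrite [RHS](orthonormal_expansion hm).
apply: eq_bigr => i _; congr (_ *: _); rewrite ipBr (ipC _ _ m).
by rewrite (orthogonal_complement_basis i Qm) subr0.
Qed.

(** The Pythagorean split of the variance of a functional between [Q] and its complement, on which
    the comparison of characteristic functions rests. *)
Lemma sqr_norm_projection h :
  `|orthogonal_projection ip Q h| ^+ 2 = `|h| ^+ 2 - \sum_i ip (e i) h ^+ 2.
Proof.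
have h1 : ip h (\sum_i ip (e i) h *: e i) = \sum_i ip (e i) h ^+ 2.
  by rewrite ip_sumr; apply: eq_bigr => i _; rewrite ipZr (ipC _ h) -expr2.
have h2 : `|\sum_i ip (e i) h *: e i| ^+ 2 = \sum_i ip (e i) h ^+ 2.
  rewrite norm_ip ip_suml; apply: eq_bigr => i _.
  by rewrite ipZl orthonormal_coord -expr2.
by rewrite sum_projectionE (sqr_normB norm_ip) h1 h2; ring.
Qed.

End OrthogonalDecomposition.

(** * Riesz vectors of continuous functionals on [B] *)

Section RieszVectors.
Context (R : realType) (H B : completeNormedModType R).
Context (ip : {dot H for idfun}) (j : {linear H -> B}).
Hypothesis norm_ip : forall h : H, `|h| ^+ 2 = ip h h.
Hypothesis cj : continuous (j : H -> B).
Hypothesis injj : injective j.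

Lemma riesz_vectorP (xs : {scalar B}) : continuous (xs : B -> R) ->
  forall k, ip (riesz_vector ip j xs) k = xs (j k).
Proof.
move=> cxs.
have lin : linear_for *%R (fun h => xs (j h)) by move=> a x y; rewrite !linearP.
have [phi phiE] := scalar_functional lin.
have [|r rP] := @riesz _ _ _ norm_ip phi.
  by rewrite phiE => x; apply: continuous_comp; [exact: cj|exact: cxs].
have {}rP k : ip r k = xs (j k) by rewrite rP phiE.
exact: (@xgetPex _ (0 : H) [set h | forall k, ip h k = xs (j k)] (ex_intro _ r rP)).
Qed.

Lemma riesz_vector_lin (xs ys zs : {scalar B}) (a : R) :
  continuous (xs : B -> R) -> continuous (ys : B -> R) ->
  continuous (zs : B -> R) -> (forall x, zs x = a * xs x + ys x) ->
  riesz_vector ip j zs = a *: riesz_vector ip j xs + riesz_vector ip j ys.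
Proof.
move=> cxs cys czs zsE; apply/eqP; rewrite -subr_eq0; apply/eqP.
apply: (ip_eq0 norm_ip); set k := (X in ip _ X).
by rewrite ipBl ipDl ipZl !riesz_vectorP// zsE subrr.
Qed.

Lemma functional_lin (xs ys : {scalar B}) (a : R) :
  continuous (xs : B -> R) -> continuous (ys : B -> R) ->
  exists2 zs : {scalar B}, continuous (zs : B -> R) &
    forall x, zs x = a * xs x + ys x.
Proof.
move=> cxs cys; pose z x := a * xs x + ys x.
have lin : linear_for *%R z.
  by move=> b x y; rewrite /z !linearP /=; ring.
have [zs zsE] := scalar_functional lin; exists zs; rewrite zsE// => x.
apply: cvgD; last exact: cys.
by apply: cvgM; [exact: cvg_cst|exact: cxs].
Qed.

Lemma functional0 : exists2 zs : {scalar B}, continuous (zs : B -> R) &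
    forall x, zs x = 0.
Proof.
have lin : linear_for *%R (fun _ : B => 0 : R) by move=> b x y; rewrite mulr0 addr0.
have [zs zsE] := scalar_functional lin; exists zs; rewrite zsE// => x.
exact: cvg_cst.
Qed.

(** If [m] is the foot point of [h] on the closure of the Riesz vectors, every continuous functional
    kills [j (h - m)]. A norming functional shows that [j (h - m)] is zero, and injectivity of [j]
    gives [h = m]. *)
Lemma riesz_vector_dense h (eps : R) : 0 < eps ->
  exists2 xs : {scalar B}, continuous (xs : B -> R) &
    `|h - riesz_vector ip j xs| < eps.
Proof.
move=> eps0.
pose S := [set r | exists2 xs : {scalar B}, continuous (xs : B -> R) &
  r = riesz_vector ip j xs].
have [||m Sm orth] := @projection_closure _ _ _ norm_ip S h.
- have [zs czs z0] := functional0; exists zs => //.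
  apply/esym/(ip_eq0 norm_ip); set k := (X in ip _ X).
  by rewrite riesz_vectorP// z0.
- move=> a _ _ [xs cxs ->] [ys cys ->].
  have [zs czs zE] := functional_lin a cxs cys; exists zs => //.
  by apply/esym/riesz_vector_lin.
have jhm : j (h - m) = 0.
  have [xs [cxs xsE _]] := normed_functional (j (h - m)).
  apply/eqP; rewrite -normr_eq0 -xsE -riesz_vectorP//; apply/eqP.
  by apply: orth; exists xs.
have hm : h = m by apply/eqP; rewrite -subr_eq0; apply/eqP/injj; rewrite jhm linear0.
have [_ [[xs cxs ->] hxs]] := Sm _ (nbhsx_ballx m eps eps0).
by exists xs => //; move: hxs; rewrite -ball_normE /= hm.
Qed.
End RieszVectors.

(** * Weighted integrals *)

Import HBNNSimple.

Section WeightedIntegral.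
Context d d' (T : measurableType d) (T' : measurableType d') (R : realType).

(** Passes from indicators to nonnegative functions by simple approximation. The weight is a density
    when [X] is the identity; in [Rintegral_weight] the same statement expresses that [w] decouples
    from [X]. *)
Lemma ge0_integral_weight (mu : {measure set T -> \bar R})
    (nu : {measure set T' -> \bar R}) (w : T -> R) (X : T -> T') (c : R) :
  measurable_fun setT w -> (forall x, 0 <= w x) -> measurable_fun setT X -> 0 <= c ->
  (forall A, measurable A ->
    (\int[mu]_x (w x * \1_A (X x))%:E = c%:E * nu A)%E) ->
  forall f : T' -> R, measurable_fun setT f -> (forall y, 0 <= f y) ->
  (\int[mu]_x (w x * f (X x))%:E = c%:E * \int[nu]_y (f y)%:E)%E.
Proof.
move=> mw w0 mX c0 wA f mf f0.
have mfE : measurable_fun setT (EFin \o f) by exact/measurable_EFinP.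
pose h := nnsfun_approx measurableT mfE.
have hf y : (EFin \o h ^~ y) @ \oo --> (f y)%:E.
  by apply: (cvg_nnsfun_approx measurableT mfE) => // z _; rewrite lee_fin.
have term0 n r z : 0 <= r * \1_(h n @^-1` [set r]) z.
  have := nnfun_muleindic_ge0 (h n) r z; by rewrite lee_fin.
have mterm n r : measurable_fun setT (fun z => r * \1_(h n @^-1` [set r]) z).
  exact: measurable_funM.
have step n : (\int[mu]_x (w x * h n (X x))%:E = c%:E * \int[nu]_y (h n y)%:E)%E.
  transitivity (\int[mu]_x (\sum_(r \in range (h n))
      (w x * (r * \1_(h n @^-1` [set r]) (X x)))%:E))%E.
    apply: eq_integral => x _.
    by rewrite {1}(fimfunE (h n)) fsumEFin// mulr_fsumr.
  rewrite ge0_integral_fsum//; last 2 first.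
  - move=> r; apply/measurable_EFinP/measurable_funM => //.
    exact: (measurableT_comp (mterm n r) mX).
  - by move=> r x _; rewrite lee_fin mulr_ge0.
  transitivity (c%:E * \int[nu]_y (\sum_(r \in range (h n))
      (r * \1_(h n @^-1` [set r]) y)%:E))%E; last first.
    congr (_ * _)%E; apply: eq_integral => y _.
    by rewrite {1}(fimfunE (h n)) fsumEFin.
  rewrite ge0_integral_fsum//; last 2 first.
  - by move=> r; exact/measurable_EFinP.
  - by move=> r x _; rewrite lee_fin.
  rewrite ge0_mule_fsumr; last first.
    by move=> r; apply: integral_ge0 => x _; rewrite lee_fin.
  apply: eq_fsbigr => r /[!inE] -[z _ <-]; set s := h n z.
  have s0 : 0 <= s by exact: fun_ge0.
  have mA : measurable (h n @^-1` [set s]) by exact: measurable_sfunP.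
  under eq_integral do rewrite mulrCA EFinM.
  rewrite ge0_integralZl_EFin//; last 2 first.
  - by move=> x _; rewrite lee_fin mulr_ge0.
  - apply/measurable_EFinP/measurable_funM => //.
    by apply: (measurableT_comp _ mX); exact: measurable_indic.
  rewrite wA// [in RHS](eq_integral (fun y => s%:E * (\1_(h n @^-1` [set s]) y)%:E)%E)//.
  rewrite ge0_integralZl_EFin//; last exact/measurable_EFinP/measurable_indic.
  by rewrite integral_indic// setIT muleCA.
have mono (n m : nat) : (n <= m)%N -> forall z, h n z <= h m z.
  by move=> nm z; exact/lefP/nd_nnsfun_approx.
transitivity (limn (fun n => \int[mu]_x (w x * h n (X x))%:E))%E.
  rewrite -monotone_convergence//.
  - apply: eq_integral => x _; apply/esym/cvg_lim => //.
    under eq_fun do rewrite EFinM.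
    by rewrite EFinM; apply: cvgeZl => //; exact: hf.
  - move=> n; apply/measurable_EFinP/measurable_funM => //.
    by apply: (measurableT_comp _ mX); exact: measurable_funP.
  - by move=> n x _; rewrite lee_fin mulr_ge0.
  - by move=> x _ n m nm; rewrite lee_fin ler_wpM2l// mono.
under eq_fun do rewrite step.
apply/cvg_lim => //; apply: cvgeZl => //.
rewrite [X in _ --> X](_ : _ = \int[nu]_y (limn (fun n => (h n y)%:E)))%E.
  apply: cvg_monotone_convergence => //.
  - by move=> n; exact/measurable_EFinP.
  - by move=> n x _; rewrite lee_fin.
  - by move=> x _ n m nm; rewrite lee_fin mono.
by apply: eq_integral => y _; apply/esym/cvg_lim => //; exact: hf.
Qed.
End WeightedIntegral.

Lemma Rintegral_EFin d (T : measurableType d) (R : realType)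
    (mu : {measure set T -> \bar R}) (f : T -> R) :
  mu.-integrable setT (EFin \o f) ->
  (\int[mu]_x (f x)%:E)%E = (\int[mu]_x f x)%:E.
Proof. by move=> fi; rewrite /Rintegral fineK//; exact: integrable_fin_num. Qed.

Lemma probability_fineK d (T : measurableType d) (R : realType)
  (P : probability T R) A : measurable A -> (fine (P A))%:E = P A.
Proof. by move=> mA; rewrite fineK//; exact: fin_num_measure. Qed.

Lemma Rintegral_prob_cst d (T : measurableType d) (R : realType)
  (P : probability T R) (c : R) : \int[P]_x c = c.
Proof.
by rewrite Rintegral_cst// [X in fine X](_ : _ = 1%E) ?mulr1//; exact: probability_setT.
Qed.

Section BoundedWeight.
Context d d' (T : measurableType d) (T' : measurableType d') (R : realType).
Variables (P : probability T R) (Q : probability T' R).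

(** Signed [w] and [f] are made nonnegative by adding their bounds [W] and [K]. Expanding
    [(w + W) * (f + K)] and cancelling the three extra terms leaves the claim. *)
Lemma Rintegral_weight (w : T -> R) (W : R) (X : T -> T') (c : R) :
  measurable_fun setT w -> (forall x, `|w x| <= W) -> measurable_fun setT X ->
  (forall A, measurable A -> P (X @^-1` A) = Q A) ->
  (forall A, measurable A -> \int[P]_x (w x * \1_A (X x)) = c * fine (Q A)) ->
  forall (f : T' -> R) (K : R), measurable_fun setT f -> (forall y, `|f y| <= K) ->
  \int[P]_x (w x * f (X x)) = c * \int[Q]_y f y.
Proof.
move=> mw wW mX XQ wA f K mf fK.
have mind A : measurable A -> measurable_fun setT (fun x => \1_A (X x) : R).
  by move=> mA; apply: measurableT_comp mX => //; exact: measurable_indic.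
have mfX : measurable_fun setT (fun x => f (X x)) by exact: measurableT_comp.
have iw : P.-integrable setT (EFin \o w) by exact: integrable_bounded wW.
have iA A : measurable A -> P.-integrable setT (EFin \o (fun x => \1_A (X x) : R)).
  move=> mA; apply: (@integrable_bounded _ _ _ _ _ 1); first exact: mind.
  by move=> x; rewrite indicE; case: (_ \in _); rewrite ?normr1 ?normr0.
have iwA A : measurable A -> P.-integrable setT (EFin \o (fun x => w x * \1_A (X x))).
  move=> mA; apply: (@integrable_bounded _ _ _ _ _ W).
    by apply: measurable_funM => //; exact: mind.
  move=> x; rewrite normrM indicE; case: (_ \in _); rewrite ?normr1 ?normr0 ?mulr1//.
  by rewrite mulr0 (le_trans _ (wW x)).
have W0 x : 0 <= w x + W by have := wW x; rewrite ler_norml; lra.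
have K0 y : 0 <= f y + K by have := fK y; rewrite ler_norml; lra.
have PA A : measurable A -> \int[P]_x \1_A (X x) = fine (Q A).
  move=> mA; rewrite /Rintegral -XQ//; congr fine.
  rewrite -[X in P X]setIT -integral_indic//.
  by rewrite -[X in measurable X]setTI; exact: mX.
have wsum : \int[P]_x w x = c.
  have := wA setT measurableT; rewrite [X in fine X](_ : _ = 1%E) ?mulr1 => [<-|]; last exact: probability_setT.
  by apply: eq_Rintegral => x _; rewrite indicT mulr1.
have step (w' : T -> R) (c' : R) : measurable_fun setT w' -> (forall x, 0 <= w' x) ->
    P.-integrable setT (EFin \o w') ->
    (forall A, measurable A -> P.-integrable setT (EFin \o (fun x => w' x * \1_A (X x)))) ->
    (forall A, measurable A -> \int[P]_x (w' x * \1_A (X x)) = c' * fine (Q A)) ->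
    \int[P]_x (w' x * (f (X x) + K)) = c' * \int[Q]_y (f y + K).
  move=> mw' w'0 iw' iw'A w'A.
  have c'0 : 0 <= c'.
    have := w'A setT measurableT; rewrite [X in fine X](_ : _ = 1%E) ?mulr1 => [<-|]; last exact: probability_setT.
    by apply: Rintegral_ge0 => x _; rewrite mulr_ge0 ?indicE.
  rewrite /Rintegral (@ge0_integral_weight _ _ _ _ _ _ Q w' X c' _ _ _ _ _ (fun y => f y + K))//.
  - rewrite fineM//; apply: integrable_fin_num => //.
    apply: (@integrable_bounded _ _ _ _ _ (K + `|K|)).
      exact: measurable_funD.
    by move=> x; rewrite (le_trans (ler_normD _ _))// lerD2r.
  - move=> A mA; rewrite Rintegral_EFin ?w'A//; last exact: iw'A.
    by rewrite EFinM probability_fineK.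
  - exact: measurable_funD.
have iWA A (mA : measurable A) : P.-integrable setT
    (EFin \o (fun x => (w x + W) * \1_A (X x))).
  apply: (@integrable_bounded _ _ _ _ _ (W + `|W|)).
    by apply: measurable_funM; [exact: measurable_funD|exact: mind].
  move=> x; rewrite normrM indicE; case: (_ \in _); rewrite ?normr1 ?normr0 ?mulr1//.
    by rewrite (le_trans (ler_normD _ _))// lerD2r.
  by rewrite mulr0 addr_ge0// (le_trans _ (wW x)).
have iW : P.-integrable setT (EFin \o (fun x => w x + W)).
  apply: (@integrable_bounded _ _ _ _ _ (W + `|W|)); first exact: measurable_funD.
  by move=> x; rewrite (le_trans (ler_normD _ _))// lerD2r.
have ifX : P.-integrable setT (EFin \o (fun x => f (X x))).
  exact: integrable_bounded mfX _.
have iwf : P.-integrable setT (EFin \o (fun x => w x * f (X x))).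
  apply: (@integrable_bounded _ _ _ _ _ (W * K)); first exact: measurable_funM.
  by move=> x; rewrite normrM ler_pM.
have i_f : Q.-integrable setT (EFin \o f) by exact: integrable_bounded fK.
have icP (r : R) : P.-integrable setT (EFin \o cst r).
  by apply: (@integrable_bounded _ _ _ _ _ `|r|).
have icQ (r : R) : Q.-integrable setT (EFin \o cst r).
  by apply: (@integrable_bounded _ _ _ _ _ `|r|).
have E1 := step (fun=> 1) 1.
(* The constant weight 1 evaluates the cross term [W * f (X x)] of the expansion. *)
have {E1} EfX : \int[P]_x f (X x) = \int[Q]_y f y.
  have : \int[P]_x (1 * (f (X x) + K)) = 1 * \int[Q]_y (f y + K).
    apply: E1 => //.
    + exact: icP.
    + by move=> A mA; under [in X in _.-integrable _ X]eq_fun do rewrite mul1r; exact: iA.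
    + by move=> A mA; under eq_Rintegral do rewrite mul1r; rewrite PA// mul1r.
  under eq_Rintegral do rewrite mul1r.
  rewrite (RintegralD _ ifX (icP K))// (RintegralD _ i_f (icQ K))//.
  rewrite !Rintegral_prob_cst mul1r.
  exact: addIr.
have := step (fun x => w x + W) (c + W).
have -> : \int[P]_x ((w x + W) * (f (X x) + K)) =
    \int[P]_x (w x * f (X x)) + K * c + W * \int[Q]_y f y + W * K.
  transitivity (\int[P]_x (((w x * f (X x) + K * w x) + W * f (X x)) + W * K)).
    by apply: eq_Rintegral => x _; ring.
  have iKw : P.-integrable setT (EFin \o (fun x => K * w x)).
    exact: (integrableZl measurableT K iw).
  have iWf : P.-integrable setT (EFin \o (fun x => W * f (X x))).
    exact: (integrableZl measurableT W ifX).
  have i12 : P.-integrable setT (EFin \o (fun x => w x * f (X x) + K * w x)).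
    exact: (integrableD measurableT iwf iKw).
  have i123 : P.-integrable setT (EFin \o (fun x => w x * f (X x) + K * w x + W * f (X x))).
    exact: (integrableD measurableT i12 iWf).
  rewrite (RintegralD _ i123 (icP (W * K)))// (RintegralD _ i12 iWf)//.
  rewrite (RintegralD _ iwf iKw)// RintegralZl// RintegralZl//.
  by rewrite Rintegral_prob_cst wsum EfX.
move=> h.
have hQ : \int[Q]_y (f y + K) = \int[Q]_y f y + K.
  by rewrite (RintegralD _ i_f (icQ K))// Rintegral_prob_cst.
have : \int[P]_x (w x * f (X x)) + K * c + W * \int[Q]_y f y + W * K =
  (c + W) * (\int[Q]_y f y + K).
  rewrite -hQ; apply: h => //; first exact: measurable_funD.
  move=> A mA.
  transitivity (\int[P]_x (w x * \1_A (X x) + W * \1_A (X x))).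
    by apply: eq_Rintegral => x _; rewrite mulrDl.
  have iWA' : P.-integrable setT (EFin \o (fun x => W * \1_A (X x))).
    exact: (integrableZl measurableT W (iA _ mA)).
  rewrite RintegralD//; last exact: iwA.
  by rewrite wA// RintegralZl ?PA ?mulrDl//; exact: iA.
move=> e; apply: (@addIr _ (K * c + W * \int[Q]_y f y + W * K)).
by rewrite !addrA e; ring.
Qed.
End BoundedWeight.

(** * Gaussian random variables *)

Section NormalCharacteristic.
Context (R : realType).
Local Notation leb := (@lebesgue_measure R).
Local Notation p := (@normal_pdf R 0 1).

Lemma normal_pdf01E x : p x = normal_peak 1 * expR (- (x ^+ 2 / 2)).
Proof.
rewrite normal_pdfE ?oner_neq0// /normal_fun subr0 expr1n mulNr.
by rewrite mulr2n.
Qed.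

Lemma is_derive_normal_pdf01 (x : R) : is_derive x (1 : R) (p : R -> R) (- x * p x).
Proof.
have -> : p = (fun y => normal_peak 1 * expR (- (y ^+ 2 / 2))).
  by apply/funext => y; rewrite normal_pdf01E.
have h : is_derive x (1 : R) (fun y : R => - (y ^+ 2 / 2)) (- x).
  by apply: is_derive_eq; rewrite /GRing.scale /=; field.
have hE : is_derive x (1 : R) (fun y : R => expR (- (y ^+ 2 / 2)))
    (expR (- (x ^+ 2 / 2)) * - x).
  exact: (@is_derive1_comp _ expR (fun y : R => - (y ^+ 2 / 2))).
by apply: is_derive_eq; rewrite /GRing.scale /=; ring.
Qed.

(** Completing the square: the exponential factor moves the mean from 0 to [s]. *)
Lemma expR_normal_pdf s x :
  expR (s * x) * p x = expR (s ^+ 2 / 2) * normal_pdf s 1 x.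
Proof.
rewrite !normal_pdfE ?oner_neq0// /normal_fun !(mulrCA _ (normal_peak 1)).
congr (_ * _); rewrite -!expRD; congr expR.
by rewrite expr1n subr0; field.
Qed.

Lemma integrable_expR_normal_pdf s :
  leb.-integrable setT (EFin \o (fun x => expR (s * x) * p x)).
Proof.
have := integrableZl measurableT (expR (s ^+ 2 / 2)) (integrable_normal_pdf s 1).
apply: eq_integrable => // x _ /=.
by rewrite expR_normal_pdf.
Qed.

(** Follows from [|x| <= expR x + expR (- x)]. This function later dominates the derivative under
    the integral sign. *)
Lemma integrable_normr_normal_pdf :
  leb.-integrable setT (EFin \o (fun x => `|x| * p x)).
Proof.
have mx : measurable_fun setT (fun x : R => `|x| * p x).
  by apply: measurable_funM; [exact: normr_measurable|exact: measurable_normal_pdf].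
have := integrableD measurableT (integrable_expR_normal_pdf 1) (integrable_expR_normal_pdf (-1)).
apply: le_integrable => //; first exact/measurable_EFinP.
move=> x _ /=; rewrite lee_fin -mulrDl !normrM.
rewrite ler_wpM2r// normr_id ger0_norm ?addr_ge0 ?expR_ge0// mul1r mulN1r.
have [x0|x0] := ger0P x.
  rewrite -[leLHS]addr0 lerD ?expR_ge0//.
  by rewrite (le_trans _ (expR_ge1Dx _))// lerDr.
rewrite -[leLHS]add0r lerD ?expR_ge0//.
by rewrite (le_trans _ (expR_ge1Dx _))// lerDr.
Qed.

Lemma integrable_bounded_normal_pdf (f : R -> R) (K : R) :
  measurable_fun setT f -> (forall x, `|f x| <= K) ->
  leb.-integrable setT (EFin \o (fun x => f x * p x)).
Proof.
move=> mf fK.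
have := integrableZl measurableT K (integrable_normal_pdf 0 1).
apply: le_integrable => //.
  by apply/measurable_EFinP/measurable_funM => //; exact: measurable_normal_pdf.
move=> x _ /=; rewrite lee_fin !normrM ler_wpM2r//.
by rewrite (le_trans (fK x)) ?ler_norm.
Qed.

(** [f t a] is the derivative of [F t a], and [F t a] vanishes at both infinities: the data of an
    integration by parts against the density. *)
Let F (t a x : R) := sin (t * x + a) * p x.
Let f (t a x : R) := (t * cos (t * x + a) - x * sin (t * x + a)) * p x.

Let dF t a x : is_derive x (1 : R) (F t a) (f t a x).
Proof.
have h : is_derive x (1 : R) (fun y : R => t * y + a) t.
  by apply: is_derive_eq; rewrite /GRing.scale /=; ring.
have hs : is_derive x (1 : R) (fun y : R => sin (t * y + a)) (cos (t * x + a) * t).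
  exact: (@is_derive1_comp _ sin (fun y : R => t * y + a)).
have hp := is_derive_normal_pdf01 x.
by apply: is_derive_eq; rewrite /GRing.scale /= /f; ring.
Qed.

Let continuous_affine (t a : R) : continuous (fun x : R => t * x + a).
Proof.
move=> x; apply: cvgD; last exact: cvg_cst.
by apply: cvgM; [exact: cvg_cst|exact: cvg_id].
Qed.

Let continuous_cos_affine (t a : R) : continuous (fun x : R => cos (t * x + a)).
Proof. by move=> x; apply: (continuous_comp (@continuous_affine t a x)); exact: continuous_cos. Qed.

Let continuous_sin_affine (t a : R) : continuous (fun x : R => sin (t * x + a)).
Proof. by move=> x; apply: (continuous_comp (@continuous_affine t a x)); exact: continuous_sin. Qed.

Let continuous_f t a : continuous (f t a).
Proof.
move=> x; apply: cvgM; last exact: continuous_normal_pdf (oner_neq0 _) x.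
apply: cvgB; apply: cvgM.
- exact: cvg_cst.
- exact: continuous_cos_affine.
- exact: cvg_id.
- exact: continuous_sin_affine.
Qed.

Let integrable_cos_pdf t a :
  leb.-integrable setT (EFin \o (fun x => cos (t * x + a) * p x)).
Proof.
apply: (@integrable_bounded_normal_pdf _ 1).
  exact: continuous_measurable_fun (@continuous_cos_affine t a).
by move=> x; rewrite ler_norml cos_geN1 cos_le1.
Qed.

Let integrable_xsin_pdf t a :
  leb.-integrable setT (EFin \o (fun x => x * sin (t * x + a) * p x)).
Proof.
have := integrable_normr_normal_pdf; apply: le_integrable => //.
  apply/measurable_EFinP/measurable_funM; last exact: measurable_normal_pdf.
  apply: measurable_funM => //.
  exact: continuous_measurable_fun (@continuous_sin_affine t a).
move=> x _ /=; rewrite lee_fin !normrM normr_id ler_wpM2r// ler_piMr//.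
by rewrite ler_norml sin_geN1 sin_le1.
Qed.

Let fE t a x : f t a x = t * (cos (t * x + a) * p x) - x * sin (t * x + a) * p x.
Proof. by rewrite /f; ring. Qed.

Let integrable_f t a : leb.-integrable setT (EFin \o f t a).
Proof.
have := integrableB measurableT
  (integrableZl measurableT t (integrable_cos_pdf t a)) (integrable_xsin_pdf t a).
by apply: eq_integrable => // x _ /=; rewrite fE.
Qed.

Let normal_pdf_le_harmonic (x : R) n : `|x| = n.+1%:R ->
  p x <= normal_peak 1 * 2 * harmonic n.
Proof.
move=> xn; rewrite normal_pdf01E -mulrA ler_wpM2l ?normal_peak_ge0//.
have n1 : 1 <= n.+1%:R :> R by rewrite ler1n.
rewrite -real_normK ?num_real// xn expRN /harmonic /=.
rewrite -[leLHS]div1r ler_pdivrMr ?expR_gt0// mulrAC ler_pdivlMr// mul1r.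
apply: (@le_trans _ _ (2 * (1 + n.+1%:R ^+ 2 / 2))); last first.
  by rewrite ler_wpM2l// expR_ge1Dx.
move: n1; set y := _%:R => y1; have : y <= y ^+ 2 by rewrite expr2 ler_peMr// (le_trans _ y1).
lra.
Qed.

(** On [[- n.+1, n.+1]] the fundamental theorem leaves two values of [F t a], each bounded by the
    density and so tending to 0; dominated convergence identifies the limit with the integral over
    the line. *)
Let integral_f t a : (\int[leb]_x (f t a x)%:E)%E = 0%E.
Proof.
pose A n : set R := [set` `[- (n.+1%:R : R), n.+1%:R] ].
have cvgA : (\int[leb]_x (f t a x * \1_(A n) x)%:E)%E @[n --> \oo] -->
    (\int[leb]_x (f t a x)%:E)%E.
  have /integrableP[mf _] := integrable_f t a.
  apply: (@dominated_cvg _ _ _ leb _ _ (fun n x => (f t a x * \1_(A n) x)%:E) _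
    (abse \o (EFin \o f t a))) => //.
  - move=> n; apply/measurable_EFinP/measurable_funM; first exact/measurable_EFinP.
    by apply: measurable_indic; exact: measurable_itv.
  - move=> x _; apply: cvg_near_cst.
    near=> n; rewrite indicE mem_set ?mulr1// /A /= in_itv /= -ler_norml.
    rewrite (@le_trans _ _ n%:R) ?ler_nat//.
    by near: n; exact: nbhs_infty_ger.
  - exact/integrable_abse/integrable_f.
  - move=> n x _; rewrite /= lee_fin normrM indicE.
    by case: (_ \in _); rewrite ?normr1 ?normr0 ?mulr1 ?mulr0.
have cvg0 : (\int[leb]_x (f t a x * \1_(A n) x)%:E)%E @[n --> \oo] --> 0%E.
  have E n : (\int[leb]_x (f t a x * \1_(A n) x)%:E)%E =
      (F t a n.+1%:R - F t a (- n.+1%:R))%:E.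
    rewrite EFinB -(@continuous_FTC2 R (f t a) (F t a)) //.
    - rewrite [RHS]integral_mkcond; apply: eq_integral => x _.
      by rewrite patchE indicE; case: ifPn => _; rewrite ?mulr1 ?mulr0.
    - by rewrite gtrN.
    - by apply: continuous_subspaceT; exact: continuous_f.
    - have cF : continuous (F t a).
        move=> x; apply: differentiable_continuous; apply/derivable1_diffP.
        by have := dF t a x => -[].
      split.
      + by move=> x _; have := dF t a x => -[].
      + exact/cvg_at_right_filter/cF.
      + exact/cvg_at_left_filter/cF.
    - by move=> x _; rewrite derive1E; exact: derive_val.
  under eq_fun do rewrite E.
  apply: cvg_EFin; first exact: nearW.
  have Fle x n : `|x| = n.+1%:R -> `|F t a x| <= normal_peak 1 * 2 * harmonic n.
    move=> xn; apply: le_trans (normal_pdf_le_harmonic xn).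
    rewrite normrM (ger0_norm (normal_pdf_ge0 _ _ _)) ler_piMl ?normal_pdf_ge0//.
    by rewrite ler_norml sin_geN1 sin_le1.
  apply/norm_cvg0P.
  apply: (@squeeze_cvgr _ _ _ _ (cst 0) (fun n => normal_peak 1 * 4 * harmonic n)).
  - apply: nearW => n /=; rewrite normr_ge0 /=.
    rewrite (le_trans (ler_normB _ _))//.
    have h1 := Fle n.+1%:R n (ger0_norm (ler0n _ _)).
    have h2 : `|F t a (- n.+1%:R)| <= normal_peak 1 * 2 * harmonic n.
      by apply: Fle; rewrite normrN ger0_norm.
    apply: le_trans (lerD h1 h2) _.
    by rewrite le_eqVlt; apply/orP; left; apply/eqP; rewrite /harmonic /=; ring.
  - exact: cvg_cst.
  - rewrite -(mulr0 (normal_peak 1 * 4)); apply: cvgM; first exact: cvg_cst.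
    exact: cvg_harmonic.
exact: (cvg_unique (@ereal_hausdorff R) cvgA cvg0).
Unshelve. all: by end_near. Qed.

Lemma normal_integration_by_parts (t a : R) :
  \int[leb]_x (x * sin (t * x + a) * p x) = t * \int[leb]_x (cos (t * x + a) * p x).
Proof.
have f0 : \int[leb]_x f t a x = 0.
  by apply: EFin_inj; rewrite -(Rintegral_EFin (integrable_f t a)) integral_f.
have : \int[leb]_x f t a x = t * \int[leb]_x (cos (t * x + a) * p x) -
    \int[leb]_x (x * sin (t * x + a) * p x).
  have i1 : leb.-integrable setT (EFin \o (fun x => t * (cos (t * x + a) * p x))).
    exact: (integrableZl measurableT t (integrable_cos_pdf t a)).
  rewrite -RintegralZl// -(RintegralB _ i1 (integrable_xsin_pdf t a))//.
  by apply: eq_Rintegral => x _; rewrite fE.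
by rewrite f0 => /esym /eqP; rewrite subr_eq0 => /eqP <-.
Qed.

Let phi (a t : R) := \int[leb]_x (cos (t * x + a) * p x).

(** Differentiating under the integral produces [- x * sin (t * x + a)], which integration by parts
    turns back into a multiple of [phi a t]. *)
Let is_derive_phi (a t : R) : is_derive t (1 : R) (phi a) (- t * phi a t).
Proof.
pose g (t x : R) := cos (t * x + a) * p x.
have dg t' x : is_derive t' (1 : R) (g^~ x) (- (x * sin (t' * x + a) * p x)).
  have h : is_derive t' (1 : R) (fun y : R => y * x + a) x.
    by apply: is_derive_eq; rewrite /GRing.scale /=; ring.
  have hc : is_derive t' (1 : R) (fun y : R => cos (y * x + a)) (- sin (t' * x + a) * x).
    exact: (@is_derive1_comp _ cos (fun y : R => y * x + a)).
  by apply: is_derive_eq; rewrite /GRing.scale /=; ring.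
have d1g t' x : partial1of2 g t' x = - (x * sin (t' * x + a) * p x).
  by rewrite partial1of2E; apply: derive_val.
have It : t \in `]t - 1, t + 1[ by rewrite in_itv /=; lra.
have hint x : x \in `]t - 1, t + 1[ -> leb.-integrable setT (EFin \o g x).
  by move=> _; exact: integrable_cos_pdf.
have hder x y : x \in `]t - 1, t + 1[ -> setT y -> derivable (g^~ y) x 1.
  by move=> _ _; have := dg x y => -[].
have G0 (y : R) : 0 <= `|y| * p y by rewrite mulr_ge0 ?normal_pdf_ge0.
have Gub x y : x \in `]t - 1, t + 1[ -> setT y -> `|partial1of2 g x y| <= `|y| * p y.
  move=> _ _; rewrite d1g normrN !normrM (ger0_norm (normal_pdf_ge0 _ _ _)).
  rewrite ler_wpM2r ?normal_pdf_ge0// ler_piMr//.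
  by rewrite ler_norml sin_geN1 sin_le1.
have der := derivable_under_integral measurableT It hint hder G0
  integrable_normr_normal_pdf Gub.
have val := differentiation_under_integral measurableT It hint hder G0
  integrable_normr_normal_pdf Gub.
apply: DeriveDef => //; rewrite -derive1E val.
under eq_Rintegral do rewrite d1g -mulN1r.
by rewrite RintegralZl// normal_integration_by_parts mulN1r mulNr.
Qed.

(* The left-hand side solves phi'(t) = - t phi(t). *)
Lemma normal_cos_pdf (t a : R) :
  \int[leb]_x (cos (t * x + a) * p x) = expR (- (t ^+ 2 / 2)) * cos a.
Proof.
pose G s := phi a s * expR (s ^+ 2 / 2).
have dG s : is_derive s (1 : R) G 0.
  have h : is_derive s (1 : R) (fun y : R => y ^+ 2 / 2) s.
    by apply: is_derive_eq; rewrite /GRing.scale /=; field.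
  have he : is_derive s (1 : R) (fun y : R => expR (y ^+ 2 / 2)) (expR (s ^+ 2 / 2) * s).
    exact: (@is_derive1_comp _ expR (fun y : R => y ^+ 2 / 2)).
  have hp := is_derive_phi a s.
  by apply: is_derive_eq; rewrite /GRing.scale /=; ring.
have := is_derive_0_is_cst t 0 dG; rewrite /G expr0n mul0r expR0 mulr1.
have -> : phi a 0 = cos a.
  rewrite /phi; under eq_Rintegral do rewrite mul0r add0r.
  rewrite RintegralZl//; last exact: integrable_normal_pdf.
  by rewrite /Rintegral integral_normal_pdf mulr1.
by move=> <-; rewrite expRN mulrC mulfK// gt_eqF// expR_gt0.
Qed.

Lemma ge0_integral_normal_prob (g : R -> R) :
  measurable_fun setT g -> (forall x, 0 <= g x) ->
  (\int[normal_prob 0 1]_x (g x)%:E = \int[leb]_x (g x * p x)%:E)%E.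
Proof.
move=> mg g0; rewrite -[LHS]mul1e.
rewrite -(@ge0_integral_weight _ _ _ _ _ leb (normal_prob 0 1) p id 1)//.
- by apply: eq_integral => x _; rewrite mulrC.
- exact: measurable_normal_pdf.
- by move=> x; exact: normal_pdf_ge0.
- move=> A mA; rewrite mul1e /= /normal_prob [RHS]integral_mkcond.
  apply: eq_integral => x _; rewrite patchE indicE.
  by case: ifPn => _; rewrite ?mulr1 ?mulr0.
Qed.

Lemma normal_prob_cos (t a : R) :
  \int[normal_prob 0 1]_x cos (t * x + a) = expR (- (t ^+ 2 / 2)) * cos a.
Proof.
rewrite -normal_cos_pdf.
have mc := continuous_measurable_fun (@continuous_cos_affine t a).
have ic : (normal_prob (0 : R) 1).-integrable setT (EFin \o (fun x => cos (t * x + a))).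
  apply: (@integrable_bounded _ _ _ _ _ 1) => // x.
  by rewrite ler_norml cos_geN1 cos_le1.
have i1 : (normal_prob (0 : R) 1).-integrable setT (EFin \o cst 1).
  by apply: (@integrable_bounded _ _ _ _ _ `|1|).
(* Adding 1 makes the cosine nonnegative, as the change to the density requires; the constant is
   cancelled afterwards. *)
have e : \int[normal_prob 0 1]_x (cos (t * x + a) + 1) =
    \int[leb]_x ((cos (t * x + a) + 1) * p x).
  congr fine; apply: ge0_integral_normal_prob; first exact: measurable_funD.
  by move=> x; have := cos_geN1 (t * x + a); lra.
move: e; rewrite (RintegralD _ ic i1)// Rintegral_prob_cst => e.
apply: (@addIr _ 1); rewrite e.
transitivity (\int[leb]_x (cos (t * x + a) * p x + p x)).
  by apply: eq_Rintegral => x _; rewrite mulrDl mul1r.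
rewrite (RintegralD _ (integrable_cos_pdf t a) (integrable_normal_pdf 0 1))//.
by rewrite [X in _ + X = _]/Rintegral integral_normal_pdf.
Qed.

Lemma normal_prob_expR (s : R) :
  (\int[normal_prob 0 1]_x (expR (s * x))%:E = (expR (s ^+ 2 / 2))%:E)%E.
Proof.
rewrite ge0_integral_normal_prob//; last first.
  by apply: continuous_measurable_fun => x; apply: continuous_comp;
    [exact: mulrl_continuous|exact: continuous_expR].
under eq_integral do rewrite expR_normal_pdf EFinM.
rewrite integralZl//; last exact: integrable_normal_pdf.
by rewrite integral_normal_pdf mule1.
Qed.
End NormalCharacteristic.

Section Law.
Context d d' (T : measurableType d) (T' : measurableType d') (R : realType).
Variables (P : probability T R) (Q : probability T' R) (X : T -> T').
Hypothesis mX : measurable_fun setT X.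
Hypothesis QE : forall A, measurable A -> Q A = P (X @^-1` A).

Lemma integral_law (f : T' -> \bar R) : measurable_fun setT f ->
  (\int[Q]_y f y = \int[P]_x f (X x))%E.
Proof.
move=> mf.
have ge0 (g : T' -> \bar R) : measurable_fun setT g -> (forall y, 0 <= g y)%E ->
    (\int[Q]_y g y = \int[P]_x g (X x))%E.
  move=> mg g0; rewrite -[RHS](@ge0_integral_pushforward _ _ _ _ _ X mX P setT g)//.
  by apply: eq_measure_integral => A mA _; exact: QE.
rewrite integralE [RHS]integralE (funepos_comp f X) (funeneg_comp f X); congr (_ - _)%E.
- by rewrite (ge0 _ (measurable_funepos mf))//.
- by rewrite (ge0 _ (measurable_funeneg mf))//.
Qed.

Lemma Rintegral_law (f : T' -> R) : measurable_fun setT f ->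
  \int[Q]_y f y = \int[P]_x f (X x).
Proof. by move=> mf; congr fine; apply: integral_law; exact/measurable_EFinP. Qed.
End Law.

Lemma law_exists d d' (T : measurableType d) (T' : measurableType d')
    (R : realType) (P : probability T R) (X : T -> T') :
  measurable_fun setT X ->
  exists Q : probability T' R, forall A, measurable A -> Q A = P (X @^-1` A).
Proof.
move=> mX; pose X' := HB.pack_for {mfun T >-> T'} X (isMeasurableFun.Build _ _ _ _ X mX).
by exists (distribution P X').
Qed.

Section GaussianVariable.
Context d (T : measurableType d) (R : realType) (P : probability T R).
Variables (Y : T -> R) (s : R).
Hypothesis mY : measurable_fun setT Y.
Hypothesis Ycos : forall t a : R,
  \int[P]_x cos (t * Y x + a) = expR (- ((t * s) ^+ 2 / 2)) * cos a.

(** [Y] and [s * z], with [z] standard normal, have the same cosine integrals. Stating the law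
    through scaling includes the degenerate case [s = 0], which occurs when a functional has no
    component in the relevant subspace. *)
Lemma gaussian_law (A : set R) : measurable A ->
  P (Y @^-1` A) = normal_prob 0 1 [set z : R | A (s * z)].
Proof.
move=> mA.
have [Q QE] := law_exists P mY.
have ms : measurable_fun setT (fun z : R => s * z) by exact: measurable_funM.
have [N NE] := law_exists (normal_prob (0 : R) 1) ms.
rewrite -QE// -[RHS]NE//.
apply: (@trig_measure_unique _ _ R Q N [set l | exists t : R, l = (fun x => t * x)]) => //.
- by exists 0; apply/funext => x; rewrite mul0r.
- move=> c _ _ [t ->] [t' ->]; exists (c * t + t'); apply/funext => x; ring.
- by move=> _ [t ->]; exact: measurable_funM.
- move=> _ a [t ->].
  have mc : measurable_fun setT (fun x : R => cos (t * x + a)).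
    apply: continuous_measurable_fun => x.
    apply: (@continuous_comp _ _ _ (fun x : R => t * x + a) cos); last exact: continuous_cos.
    by apply: cvgD; [apply: cvgM; [exact: cvg_cst|exact: cvg_id]|exact: cvg_cst].
  rewrite (Rintegral_law mY QE mc) (@Rintegral_law _ _ _ _ _ (normal_prob (0 : R) 1) _ _ ms NE _ mc) Ycos.
  under eq_Rintegral do rewrite mulrA.
  by rewrite normal_prob_cos.
- apply: (@subset_trans _ <<s @RGenOInfty.G R >>).
    have e : <<s @ocitv R >> = <<s @RGenOInfty.G R >> by exact: RGenOInfty.measurableE.
    by rewrite -e.
  apply: sub_sigma_algebra2 => _ [x ->].
  exists (fun x => 1 * x), x; split; first by exists 1.
  by apply/seteqP; split=> y /=; rewrite in_itv /= andbT mul1r.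
Qed.

Lemma gaussian_integral (f : R -> \bar R) : measurable_fun setT f ->
  (\int[P]_x f (Y x) = \int[normal_prob 0 1]_z f (s * z)%R)%E.
Proof.
move=> mf.
have [Q QE] := law_exists P mY.
have ms : measurable_fun setT (fun z : R => s * z) by exact: measurable_funM.
rewrite -(integral_law mY QE mf) (@integral_law _ _ _ _ _ (normal_prob (0 : R) 1) _ _ ms _ _ mf)// => A mA.
by rewrite QE// gaussian_law.
Qed.

Lemma gaussian_expR t : (\int[P]_x (expR (t * Y x))%:E = (expR ((t * s) ^+ 2 / 2))%:E)%E.
Proof.
rewrite (gaussian_integral (f := fun y => (expR (t * y))%:E)).
  by under eq_integral do rewrite mulrA; rewrite normal_prob_expR.
apply/measurable_EFinP/measurableT_comp; first exact: measurable_expR.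
exact: measurable_funM.
Qed.

Lemma gaussian_sqr : (\int[P]_x (Y x ^+ 2)%:E =
  (s ^+ 2)%:E * \int[normal_prob 0 1]_z (z ^+ 2)%:E)%E.
Proof.
rewrite (gaussian_integral (f := fun y => (y ^+ 2)%:E)); last first.
  by apply/measurable_EFinP; exact: measurable_funX.
under eq_integral do rewrite exprMn EFinM.
rewrite ge0_integralZl_EFin ?sqr_ge0//; first by move=> z _; rewrite lee_fin sqr_ge0.
by apply/measurable_EFinP; exact: measurable_funX.
Qed.
End GaussianVariable.

(** Exponential moments control the second one, through [z ^+ 2 <= 2 * (expR z + expR (- z))]. *)
Lemma normal_prob_sqr_lty (R : realType) :
  (\int[@normal_prob R 0 1]_z (z ^+ 2)%:E < +oo)%E.
Proof.
have mE (t : R) : measurable_fun setT (fun z : R => (expR (t * z))%:E).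
  by apply/measurable_EFinP/measurableT_comp; [exact: measurable_expR|exact: measurable_funM].
apply: (@le_lt_trans _ _ (\int[@normal_prob R 0 1]_z
   (2%:E * ((expR (1 * z))%:E + (expR (-1 * z))%:E)))%E).
  apply: ge0_le_integral => //.
  - by move=> z _; rewrite lee_fin sqr_ge0.
  - by apply/measurable_EFinP; exact: measurable_funX.
  - by apply: measurable_funeM; apply: emeasurable_funD; exact: mE.
  - move=> z _; rewrite -EFinD -EFinM lee_fin mul1r mulN1r.
    have h (x : R) : 0 <= x -> x ^+ 2 <= 2 * expR x.
      move=> x0; have : 1 + x ^+ 2 / 2 <= expR x by exact: (expR_ge1Dxn 1 x0).
      lra.
    have [z0|z0] := leP 0 z.
      by have := h z z0; have := expR_ge0 (- z); lra.
    have := h (- z); rewrite sqrrN oppr_ge0 => /(_ (ltW z0)).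
    have := expR_ge0 z; lra.
rewrite ge0_integralZl//; last 2 first.
- by apply: emeasurable_funD; exact: mE.
- by move=> z _; rewrite -EFinD lee_fin addr_ge0 ?expR_ge0.
rewrite ge0_integralD//.
- by rewrite !normal_prob_expR -EFinD -EFinM ltry.
- exact: mE.
- exact: mE.
Qed.

Lemma borel_continuous_measurable (R : realType) (V : ptopologicalType) (g : V -> R) :
  continuous g -> measurable_fun setT (g : borel V -> R).
Proof.
move=> cg; apply: (measurability _ (RGenOInfty.measurableE R)).
move=> _ [_ [x ->] <-]; rewrite setTI; apply: sub_sigma_algebra.
by apply: open_comp; [move=> y _; exact: cg|exact: interval_open].
Qed.

(** * Linear combinations of independent standard normal variables *)

Section IndependentNormals.
Context d (T : measurableType d) (R : realType) (P : probability T R).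
Variables (n : nat) (xi : 'I_n -> T -> R).
Hypothesis mxi : forall i, measurable_fun setT (xi i).
Hypothesis Pxi : forall A : 'I_n -> set R, (forall i, measurable (A i)) ->
  P [set x | forall i, A i (xi i x)] = (\prod_(i < n) normal_prob 0 1 (A i))%E.

Let E (A : 'I_n -> set R) := [set x | forall i, A i (xi i x)].

Let mE A : (forall i, measurable (A i)) -> measurable (E A).
Proof.
move=> mA; rewrite (_ : E A = \bigcap_(i in [set: 'I_n]) (xi i @^-1` A i)).
  apply: fin_bigcap_measurable => [|i _]; first exact: finite_finset.
  by rewrite -[X in measurable X]setTI; exact: mxi.
by apply/seteqP; split=> [x EA i _|x h i]; [exact: EA|exact: h].
Qed.

Lemma measurable_linear_combination (c : 'I_n -> R) :
  measurable_fun setT (fun x => \sum_i c i * xi i x).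
Proof.
by apply: measurable_sum => i; exact: measurable_funM.
Qed.

Let measurable_cos_combination c (a : R) :
  measurable_fun setT (fun x => cos (\sum_i c i * xi i x + a)).
Proof.
apply: measurableT_comp; first exact: continuous_measurable_fun (@continuous_cos R).
by apply: measurable_funD => //; exact: measurable_linear_combination.
Qed.

(* Coordinates below [k] carry a cosine, the others an indicator; the induction
   turns indicators into cosines one coordinate at a time. *)
Let step k : (k <= n)%N -> forall c A (a : R), (forall i, measurable (A i)) ->
  (forall i : 'I_n, (k <= i)%N -> c i = 0) ->
  (forall i : 'I_n, (i < k)%N -> A i = setT) ->
  \int[P]_x (cos (\sum_i c i * xi i x + a) * \1_(E A) x) =
  expR (- ((\sum_i c i ^+ 2) / 2)) * cos a * fine (P (E A)).
Proof.
elim: k => [_ c A a mA c0 _|k IH kn c A a mA c0 AT].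
  transitivity (\int[P]_x (cos a * \1_(E A) x)).
    apply: eq_Rintegral => x _; rewrite big1 ?add0r// => i _.
    by rewrite c0// mul0r.
  rewrite RintegralZl//.
    rewrite big1 ?mul0r ?oppr0 ?expR0 ?mul1r => [|i _]; last by rewrite c0// expr0n.
    by rewrite /Rintegral integral_indic ?setIT//; exact: mE.
  apply: (@integrable_bounded _ _ _ _ _ 1); first exact/measurable_indic/mE.
  by move=> x; rewrite indicE; case: (_ \in _); rewrite ?normr1 ?normr0.
pose k0 := Ordinal kn.
pose c' i := if i == k0 then 0 else c i.
have sumE (F : 'I_n -> R -> R) : (forall i, F i 0 = 0) ->
    \sum_i F i (c i) = F k0 (c k0) + \sum_i F i (c' i).
  move=> F0; rewrite (bigD1 k0)//= [in RHS](bigD1 k0)//= /c' eqxx F0 add0r.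
  by congr (_ + _); apply: eq_bigr => i /negbTE ->.
have c'0 (i : 'I_n) : (k <= i)%N -> c' i = 0.
  rewrite /c'; case: eqVneq => // ik ki; apply: c0.
  by rewrite ltn_neqAle ki andbT; apply: contra ik => /eqP ik; apply/eqP/val_inj.
have A'T (B : set R) (i : 'I_n) : (i < k)%N -> (if i == k0 then B else A i) = setT.
  by move=> ik; rewrite -val_eqE /= ltn_eqF// AT// (ltn_trans ik).
have Ak0 : A k0 = setT by apply: AT => /=.
have xilaw B : measurable B -> P (xi k0 @^-1` B) = normal_prob 0 1 B.
  move=> mB; pose A0 i := if i == k0 then B else setT.
  have -> : xi k0 @^-1` B = E A0.
    apply/seteqP; split=> x /=; last by move=> /(_ k0); rewrite /A0 eqxx.
    by move=> h i; rewrite /A0; case: eqP => [->|].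
  rewrite Pxi; last by move=> i; rewrite /A0; case: ifP.
  rewrite (bigD1 k0)//= big1 ?mule1 /A0 ?eqxx// => i /negbTE ->.
  exact: probability_setT.
have PE B : measurable B -> fine (P (E (fun i => if i == k0 then B else A i))) =
    fine (P (E A)) * fine (normal_prob 0 1 B).
  move=> mB; rewrite !Pxi//; last by move=> i; case: ifP.
  rewrite (bigD1 k0)//= [in RHS](bigD1 k0)//= eqxx Ak0.
  rewrite (_ : normal_prob 0 1 setT = 1%E); last exact: (probability_setT (normal_prob (0 : R) 1)).
  rewrite mul1e (eq_bigr (fun i => normal_prob 0 1 (A i))); last by move=> i /negbTE ->.
  rewrite fineM 1?mulrC//; first exact: fin_num_measure.
  by apply: prode_fin_num => i _; exact: (fin_num_measure (normal_prob (0 : R) 1) _ (mA i)).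
(* As [A k0] is the whole line, an indicator of [B] at coordinate [k0] can be absorbed into the
   rectangle, where the induction hypothesis applies. [Rintegral_weight] then replaces that
   indicator by any function bounded by 1, in particular a cosine. *)
have wA (b : R) B : measurable B ->
    \int[P]_x (cos (\sum_i c' i * xi i x + b) * \1_(E A) x * \1_B (xi k0 x)) =
    expR (- ((\sum_i c' i ^+ 2) / 2)) * cos b * fine (P (E A)) * fine (normal_prob 0 1 B).
  move=> mB; have mAB i : measurable (if i == k0 then B else A i) by case: ifP.
  have hIH := IH (ltnW kn) c' (fun i => if i == k0 then B else A i) b mAB c'0 (A'T B).
  rewrite -mulrA -PE// -hIH.
  apply: eq_Rintegral => x _; rewrite -mulrA; congr (_ * _).
  rewrite !indicE -natrM mulnb; congr (nat_of_bool _)%:R.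
  apply/idP/idP; rewrite !inE.
    by move=> /andP[/set_mem EA /set_mem xB] i; case: eqP => [->|].
  move=> h; apply/andP; split; apply: mem_set; last by have := h k0; rewrite eqxx.
  by move=> i; have := h i; case: eqP => [->|//]; rewrite Ak0.
have wf (b : R) (f : R -> R) : measurable_fun setT f -> (forall y, `|f y| <= 1) ->
    \int[P]_x (cos (\sum_i c' i * xi i x + b) * \1_(E A) x * f (xi k0 x)) =
    expR (- ((\sum_i c' i ^+ 2) / 2)) * cos b * fine (P (E A)) *
    \int[normal_prob 0 1]_y f y.
  move=> mf f1; apply: (@Rintegral_weight _ _ _ _ _ P (normal_prob 0 1)
    (fun x => cos (\sum_i c' i * xi i x + b) * \1_(E A) x) 1 (xi k0) _ _ _ _ _ _ _ 1) => //.
  - by apply: measurable_funM => //; exact/measurable_indic/mE.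
  - move=> x; rewrite normrM indicE; case: (_ \in _); rewrite ?normr1 ?normr0 ?mulr0 ?mulr1//.
    by rewrite ler_norml cos_geN1 cos_le1.
  - exact: mxi.
  - by move=> B mB; exact: wA.
have mcos (t b : R) : measurable_fun setT (fun y => cos (t * y + b)).
  apply: measurableT_comp; first exact: continuous_measurable_fun (@continuous_cos R).
  by apply: measurable_funD => //; exact: measurable_funM.
have cos1 (y : R) : `|cos y| <= 1 by rewrite ler_norml cos_geN1 cos_le1.
(* With [s] the sum over the other coordinates and [y] the new term, [cos (s + y + a)] is [cos (s +
   a) * cos y + cos (s + a + pi / 2) * cos (y - pi / 2)]. The second product integrates to 0 because
   [cos (- (pi / 2)) = 0]. *)
have h1 := wf a _ (mcos (c k0) 0) (fun y => cos1 _).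
have h2 := wf (a + pi / 2) _ (mcos (c k0) (- (pi / 2))) (fun y => cos1 _).
rewrite !normal_prob_cos cos0 in h1 h2; rewrite cosN cos_pihalf !mulr0 in h2.
have i_ (b b' : R) : P.-integrable setT (EFin \o (fun x =>
    cos (\sum_i c' i * xi i x + b) * \1_(E A) x * cos (c k0 * xi k0 x + b'))).
  apply: (@integrable_bounded _ _ _ _ _ 1).
    apply: measurable_funM; last by apply: (measurableT_comp (mcos _ _)); exact: mxi.
    by apply: measurable_funM => //; exact/measurable_indic/mE.
  move=> x; rewrite !normrM indicE.
  by case: (_ \in _); rewrite ?normr1 ?normr0 ?mulr0 ?mul0r ?mulr1// mulr_ile1.
rewrite (sumE (fun _ y => y ^+ 2)) ?expr0n//.
transitivity (\int[P]_x (
   cos (\sum_i c' i * xi i x + a) * \1_(E A) x * cos (c k0 * xi k0 x + 0) +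
   cos (\sum_i c' i * xi i x + (a + pi / 2)) * \1_(E A) x * cos (c k0 * xi k0 x - pi / 2))).
  apply: eq_Rintegral => x _.
  rewrite (sumE (fun i y => y * xi i x)); last by move=> i; rewrite mul0r.
  have cosB (z : R) : cos (z - pi / 2) = sin z by rewrite -sinDpihalf subrK.
  set s := \sum_i _; rewrite addr0 (addrA s) cosDpihalf cosB -addrA cosD; ring.
rewrite (RintegralD _ (i_ _ _) (i_ _ _))// h1 h2 addr0 mulr1 mulrDl opprD expRD; ring.
Qed.

Lemma independent_normals_cos c (a : R) :
  \int[P]_x cos (\sum_i c i * xi i x + a) = expR (- ((\sum_i c i ^+ 2) / 2)) * cos a.
Proof.
have := step (leqnn n) (c := c) (A := fun=> setT) a.
have -> : E (fun=> setT) = setT by apply/seteqP; split.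
rewrite [X in fine X](_ : _ = 1%E) ?mulr1; last exact: probability_setT.
move=> <- //; first by apply: eq_Rintegral => x _; rewrite indicT mulr1.
by move=> i; rewrite leqNgt ltn_ord.
Qed.
End IndependentNormals.

(** * Disintegration of Wiener measure *)

Lemma integral_law_integrable d d' (T : measurableType d) (T' : measurableType d')
    (R : realType) (P : probability T R) (Q : probability T' R) (X : T -> T')
    (f : T' -> \bar R) :
  measurable_fun setT X ->
  (forall A, measurable A -> Q A = P (X @^-1` A)) ->
  Q.-integrable setT f -> P.-integrable setT (fun x => f (X x)).
Proof.
move=> mX QE /integrableP[mf fi]; apply/integrableP; split.
  exact: measurableT_comp mX.
by rewrite -(integral_law mX QE (f := fun y => `|f y|%E))//; exact: measurableT_comp.
Qed.

(** * Product probabilities and measurability tested on functionals *)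

Section ProductProbability.
Context d1 d2 (T1 : measurableType d1) (T2 : measurableType d2) (R : realType).
Variables (P1 : probability T1 R) (P2 : probability T2 R).

Let prod_setT : (P1 \x P2)%E setT = 1%E.
Proof.
rewrite -setXTT product_measure1E//.
by rewrite [X in (X * _)%E](probability_setT P1) mul1e; exact: probability_setT.
Qed.

Definition prod_probability : probability (T1 * T2)%type R :=
  HB.pack_for (probability (T1 * T2)%type R) (P1 \x P2)%E
    (Measure_isProbability.Build _ _ _ (P1 \x P2)%E prod_setT).

Lemma prod_tonelli (f : T1 * T2 -> \bar R) : measurable_fun setT f ->
  (forall z, 0 <= f z)%E ->
  (\int[prod_probability]_z f z = \int[P1]_x \int[P2]_y f (x, y))%E.
Proof. by move=> mf f0; exact: fubini_tonelli1. Qed.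

Lemma prod_fubini (f : T1 * T2 -> \bar R) : prod_probability.-integrable setT f ->
  (\int[prod_probability]_z f z = \int[P1]_x \int[P2]_y f (x, y))%E.
Proof. by move=> fi; rewrite -(integral12_prod_meas1 fi). Qed.

Lemma prod_ae_integrable (f : T1 * T2 -> \bar R) :
  prod_probability.-integrable setT f ->
  {ae P1, forall x, P2.-integrable setT (fun y => f (x, y))}.
Proof. by move=> fi; exact: (ae_integrable1 fi). Qed.

Lemma prod_measurable_fubini (f : T1 * T2 -> \bar R) :
  prod_probability.-integrable setT f ->
  measurable_fun setT (fun x => \int[P2]_y f (x, y))%E.
Proof. by move=> fi; exact: (measurable_fubini_F fi). Qed.

Lemma prod_integral_fst (f : T1 -> \bar R) : measurable_fun setT f ->
  (forall x, 0 <= f x)%E ->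
  (\int[prod_probability]_z f z.1 = \int[P1]_x f x)%E.
Proof.
move=> mf f0; rewrite prod_tonelli//; last exact: measurableT_comp.
apply: eq_integral => x _ /=; rewrite integral_cst//.
by rewrite [X in (_ * X)%E](probability_setT P2) mule1.
Qed.

Lemma prod_integral_snd (f : T2 -> \bar R) : measurable_fun setT f ->
  (forall x, 0 <= f x)%E ->
  (\int[prod_probability]_z f z.2 = \int[P2]_x f x)%E.
Proof.
move=> mf f0; rewrite prod_tonelli//; last exact: measurableT_comp.
rewrite /= (integral_cst P1 measurableT); by rewrite [X in (_ * X)%E](probability_setT P1) mule1.
Qed.
End ProductProbability.

(** The complex equation holds both the cosine and the sine integral; the addition formula combines
    them into the phase-shifted cosines on which measures are compared. *)
Lemma cexp_cos d (T : measurableType d) (R : realType) (P : probability T R)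
    (Y : T -> R) (r th : R) : measurable_fun setT Y ->
  cintegral P setT (fun x => cexp (0 +i* Y x)) = cexp (r +i* th) ->
  forall a, \int[P]_x cos (Y x + a) = expR r * cos (th + a).
Proof.
move=> mY; rewrite /cintegral /cexp /= => -[].
under eq_Rintegral do rewrite expR0 mul1r.
under [in X in _ -> X -> _]eq_Rintegral do rewrite expR0 mul1r.
move=> hc hs a.
have ic : P.-integrable setT (EFin \o (fun x => cos (Y x) * cos a)).
  apply: (@integrable_bounded _ _ _ _ _ 1).
    apply: measurable_funM => //; apply: measurableT_comp => //.
    exact: continuous_measurable_fun (@continuous_cos R).
  by move=> x; rewrite normrM mulr_ile1// ler_norml cos_geN1 cos_le1.
have is_ : P.-integrable setT (EFin \o (fun x => sin (Y x) * sin a)).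
  apply: (@integrable_bounded _ _ _ _ _ 1).
    apply: measurable_funM => //; apply: measurableT_comp => //.
    exact: continuous_measurable_fun (@continuous_sin R).
  by move=> x; rewrite normrM mulr_ile1// ler_norml sin_geN1 sin_le1.
under eq_Rintegral do rewrite cosD.
rewrite (RintegralB _ ic is_)// !RintegralZr//.
- by rewrite hc hs cosD; ring.
- apply: (@integrable_bounded _ _ _ _ _ 1) => [|x].
    by apply: measurableT_comp => //; exact: continuous_measurable_fun (@continuous_sin R).
  by rewrite ler_norml sin_geN1 sin_le1.
- apply: (@integrable_bounded _ _ _ _ _ 1) => [|x].
    by apply: measurableT_comp => //; exact: continuous_measurable_fun (@continuous_cos R).
  by rewrite ler_norml cos_geN1 cos_le1.
Qed.

Section FunctionalMeasurability.
Context (R : realType) (B : completeNormedModType R) (g : nat -> B).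
Hypothesis dg : dense_seq g.

(** Half-spaces generate the Borel sets of [B]. This makes the vector sum in [T] measurable without
    any description of the Borel sets of a product of Banach spaces. *)
Lemma measurable_of_functionals d (T : measurableType d) (X : T -> borel B) :
  (forall xs : {scalar B}, continuous (xs : B -> R) ->
    measurable_fun setT (fun t => xs (X t))) ->
  measurable_fun setT X.
Proof.
move=> hX _ A mA; rewrite setTI.
have := borel_functionals dg mA.
apply: (@smallest_sub _ _ _ [set A | measurable (X @^-1` A)]).
- split=> /=.
  + by rewrite preimage_set0.
  + by move=> C mC; rewrite setTD preimage_setC; exact: measurableC.
  + by move=> F mF; rewrite preimage_bigcup; exact: bigcupT_measurable.
- move=> _ [l [b [[xs cxs ->] ->]]] /=.
  rewrite (_ : _ @^-1` _ = setT `&` (fun t => xs (X t)) @^-1` `]b, +oo[).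
    by apply: hX.
  by rewrite setTI; apply/seteqP; split=> t /=; rewrite in_itv /= andbT.
Qed.

Lemma functional_measure_unique (P Q : probability (borel B) R) :
  (forall xs : {scalar B}, continuous (xs : B -> R) -> forall a,
    \int[P]_x cos (xs x + a) = \int[Q]_x cos (xs x + a)) ->
  forall A, measurable A -> P A = Q A.
Proof.
move=> PQ; apply: (@trig_measure_unique _ _ R P Q (@continuous_functional R B)).
- by have [zs czs z0] := functional0 B; exists zs => //; apply/funext => x; rewrite z0.
- move=> c _ _ [xs cxs ->] [ys cys ->].
  have [zs czs zE] := functional_lin c cxs cys; exists zs => //.
  by apply/funext => x; rewrite zE.
- by move=> _ [xs cxs ->]; exact: borel_continuous_measurable.
- by move=> _ a [xs cxs ->]; exact: PQ.
- exact: borel_functionals dg.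
Qed.
End FunctionalMeasurability.

Lemma prod_Rfubini d1 d2 (T1 : measurableType d1) (T2 : measurableType d2)
    (R : realType) (P1 : probability T1 R) (P2 : probability T2 R)
    (f : T1 * T2 -> R) (K : R) :
  measurable_fun setT f -> (forall z, `|f z| <= K) ->
  \int[prod_probability P1 P2]_z f z = \int[P1]_x \int[P2]_y f (x, y).
Proof.
move=> mf fK; rewrite /Rintegral prod_fubini; last exact: integrable_bounded fK.
congr fine; apply: eq_integral => x _; rewrite -Rintegral_EFin//.
apply: (@integrable_bounded _ _ _ _ _ K) => //.
exact: (measurableT_comp mf (measurable_pair1 x)).
Qed.

Section Disintegration.
Context (R : realType) (H B : completeNormedModType R).
Context (ip : {dot H for idfun}) (j : {linear H -> B}).
Context (mu : probability (borel B) R).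
Hypothesis hW : abstract_wiener_space ip j mu.
Variable Q0 : set H.
Hypothesis hQ0 : closed_subspace Q0.
Local Notation M := (orthogonal_complement ip Q0).
Variable gamma : probability (borel H) R.
Variables (n : nat) (e : 'I_n -> H).
Hypothesis he : orthonormal_basis ip M e.
Hypothesis gammaM : gamma M = 1%E.
Hypothesis gamma_rect : forall A : 'I_n -> set R, (forall i, measurable (A i)) ->
  gamma [set p | forall i, A i (ip (e i) p)]
  = (\prod_(i < n) normal_prob 0 1 (A i))%E.
Variable muQ : H -> probability (borel B) R.
Hypothesis hmuQ : forall p, M p -> affine_gaussian ip j Q0 p (muQ p).

Local Notation rv := (riesz_vector ip j).
Let norm_ip := aws_norm hW.
Let cj := aws_continuous hW.
Let injj := aws_injective hW.

Let M0 : M 0.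
Proof. by move=> q _; rewrite ip0r. Qed.

Let proj (p : H) := \sum_i ip (e i) p *: e i.

Let projM p : M p -> proj p = p.
Proof. by move=> Mp; rewrite [RHS](orthonormal_expansion he Mp). Qed.

Let ip_proj h p : ip h (proj p) = \sum_i ip (e i) h * ip (e i) p.
Proof. by rewrite ip_sumr; apply: eq_bigr => i _; rewrite ipZr mulrC (ipC _ h). Qed.

Let mip h : measurable_fun setT (ip h : borel H -> R).
Proof. by apply: borel_continuous_measurable; exact: ip_continuous. Qed.

Let mip_proj h : measurable_fun setT ((fun p => ip h (proj p)) : borel H -> R).
Proof.
under eq_fun do rewrite ip_proj.
exact: (@measurable_linear_combination _ (borel H) R n (fun i => ip (e i)) (fun i => mip (e i))).
Qed.

Let mfunc (xs : {scalar B}) : continuous (xs : B -> R) ->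
  measurable_fun setT (xs : borel B -> R).
Proof. exact: borel_continuous_measurable. Qed.

Let dense_B : exists g : nat -> B, dense_seq g.
Proof.
have [g dg] := separable_dense_seq (aws_separable hW).
by exists (j \o g); apply: dense_seq_image => //; exact: aws_dense hW.
Qed.

Let mu_cos (xs : {scalar B}) (a : R) : continuous (xs : B -> R) ->
  \int[mu]_x cos (xs x + a) = expR (- (`|rv xs| ^+ 2 / 2)) * cos a.
Proof.
move=> cxs; rewrite (cexp_cos (mfunc cxs) (aws_wiener hW cxs)) add0r.
by congr (expR _ * _); field.
Qed.

Let muQ_cos p (xs : {scalar B}) (a : R) : M p -> continuous (xs : B -> R) ->
  \int[muQ p]_x cos (xs x + a) =
  expR (- (`|orthogonal_projection ip Q0 (rv xs)| ^+ 2 / 2)) * cos (xs (j p) + a).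
Proof.
move=> Mp cxs; rewrite (cexp_cos (mfunc cxs) (hmuQ Mp cxs)).
by congr (expR _ * _); field.
Qed.

Let gamma_cos h (t a : R) : \int[gamma]_p cos (t * ip h (proj p) + a) =
  expR (- ((t * Num.sqrt (\sum_i ip (e i) h ^+ 2)) ^+ 2 / 2)) * cos a.
Proof.
have := @independent_normals_cos _ (borel H) R gamma n (fun i => ip (e i))
  (fun i => mip (e i)) gamma_rect (fun i => t * ip (e i) h) a.
rewrite exprMn sqr_sqrtr; last by apply: sumr_ge0 => i _; exact: sqr_ge0.
rewrite mulr_sumr => E; rewrite -(eq_bigr _ (fun i _ => exprMn _ _ _)) -E.
apply: eq_Rintegral => p _; rewrite ip_proj mulr_sumr.
by under eq_bigr do rewrite mulrA.
Qed.

Let rvZ (xs zs : {scalar B}) (t : R) : continuous (xs : B -> R) ->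
  continuous (zs : B -> R) -> (forall x, zs x = t * xs x) -> rv zs = t *: rv xs.
Proof.
move=> cxs czs zE; apply/eqP; rewrite -subr_eq0; apply/eqP.
apply: (ip_eq0 norm_ip); set k := (X in ip _ X).
by rewrite ipBl ipZl !riesz_vectorP// zE subrr.
Qed.

(** The factor [t] is absorbed into the functional, whose Riesz vector and projection scale with it.
    The result has the form that the lemmas on Gaussian variables ask for. *)
Let muQ0_cos (xs : {scalar B}) (t a : R) : continuous (xs : B -> R) ->
  \int[muQ 0]_x cos (t * xs x + a) =
  expR (- ((t * `|orthogonal_projection ip Q0 (rv xs)|) ^+ 2 / 2)) * cos a.
Proof.
move=> cxs; have [os cts_os os0] := functional0 B.
have [zs czs zE] := functional_lin t cxs cts_os.
have {}zE x : zs x = t * xs x by rewrite zE os0 addr0.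
transitivity (\int[muQ 0]_x cos (zs x + a)).
  by apply: eq_Rintegral => x _; rewrite zE.
rewrite muQ_cos// !linear0 add0r; congr (expR (- (_ / 2)) * _).
rewrite exprMn !(sqr_norm_projection norm_ip hQ0 he) (rvZ cxs czs zE).
rewrite normrZ exprMn real_normK ?num_real// mulrBr mulr_sumr; congr (_ - _).
by apply: eq_bigr => i _; rewrite ipZr exprMn.
Qed.

Local Notation P := (prod_probability gamma (muQ 0)).
(* Projecting [z.1] makes identities that hold for [z.1] in [M] hold everywhere. *)
Let T (z : borel H * borel B) : borel B := j (proj z.1) + z.2.

Let xsT (xs : {scalar B}) z : continuous (xs : B -> R) ->
  xs (T z) = ip (rv xs) (proj z.1) + xs z.2.
Proof. by move=> cxs; rewrite /T linearD riesz_vectorP. Qed.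

Let measurable_xsT (xs : {scalar B}) : continuous (xs : B -> R) ->
  measurable_fun setT (fun z => xs (T z)).
Proof.
move=> cxs; under eq_fun do rewrite xsT//.
apply: measurable_funD.
  exact: (measurableT_comp (mip_proj _) measurable_fst).
exact: (measurableT_comp (mfunc cxs) measurable_snd).
Qed.

Let mT : measurable_fun setT T.
Proof.
have [g dg] := dense_B.
by apply: (measurable_of_functionals dg) => xs cxs; exact: measurable_xsT.
Qed.

Let mcos_comp d (S : measurableType d) (Y : S -> R) (a : R) :
  measurable_fun setT Y -> measurable_fun setT (fun x => cos (Y x + a)).
Proof.
move=> mY; apply: (measurableT_comp (continuous_measurable_fun (@continuous_cos R))).
exact: measurable_funD.
Qed.

(** For fixed [p] the first summand of [xs (T z)] is only a phase, so integrating over [muQ 0]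
    yields the constant factor of the [Q0] component. The remaining [gamma] integral yields that of
    the coordinates, and the exponents add up by [sqr_norm_projection]. *)
Let mu_law A : measurable A -> mu A = P (T @^-1` A).
Proof.
have [g dg] := dense_B; have [Q QE] := law_exists P mT.
move=> mA; rewrite -QE//; apply: (functional_measure_unique dg) => // xs cxs a.
rewrite (Rintegral_law mT QE) ?mu_cos//; last exact: (mcos_comp _ (mfunc cxs)).
rewrite (@prod_Rfubini _ _ _ _ _ _ _ _ 1); last 2 first.
- exact: (mcos_comp _ (measurable_xsT cxs)).
- by move=> z; rewrite ler_norml cos_geN1 cos_le1.
transitivity (\int[gamma]_p (cos (1 * ip (rv xs) (proj p) + a) *
    expR (- (`|orthogonal_projection ip Q0 (rv xs)| ^+ 2 / 2)))).
  rewrite RintegralZr//; last first.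
    apply: (@integrable_bounded _ _ _ _ _ 1).
      by apply: mcos_comp; apply: measurable_funM => //; exact: mip_proj.
    by move=> x; rewrite ler_norml cos_geN1 cos_le1.
  rewrite gamma_cos mul1r sqr_sqrtr; last by apply: sumr_ge0 => i _; exact: sqr_ge0.
  rewrite [RHS]mulrAC -expRD (sqr_norm_projection norm_ip hQ0 he).
  by congr (expR _ * _); field.
apply: eq_Rintegral => p _.
transitivity (\int[muQ 0]_y cos (1 * xs y + (ip (rv xs) (proj p) + a))).
  rewrite muQ0_cos// !mul1r mulrC; congr (expR (- (_ / 2)) * _).
by apply: eq_Rintegral => y _; rewrite xsT//=; congr cos; ring.
Qed.

Let muQ_law p A : M p -> measurable A ->
  muQ p A = muQ 0 ((fun y => T (p, y)) @^-1` A).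
Proof.
have mTp : measurable_fun setT ((fun y => T (p, y)) : borel B -> borel B).
  exact: (measurableT_comp mT (measurable_pair1 (p : borel H))).
have [g dg] := dense_B; have [Q QE] := law_exists (muQ 0) mTp.
move=> Mp mA; rewrite -QE//; apply: (functional_measure_unique dg) => // xs cxs a.
rewrite (Rintegral_law mTp QE) ?muQ_cos//; last exact: (mcos_comp _ (mfunc cxs)).
transitivity (\int[muQ 0]_y cos (1 * xs y + (xs (j p) + a))).
  by rewrite muQ0_cos// mul1r.
by apply: eq_Rintegral => y _; rewrite /T /= projM// linearD; congr cos; ring.
Qed.

(** * The Paley-Wiener map composed with [T] *)

Variable I : H -> borel B -> R.
Hypothesis hI : paley_wiener ip j mu I.

Let mI h : measurable_fun setT (I h).
Proof.
have [h1 _ _ _] := hI; have := h1 h.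
by rewrite inE => /andP[/set_mem].
Qed.

Let Lnorm2_sqr (f : borel B -> R) (eps : R) : 0 <= eps ->
  (Lnorm mu 2%:E (EFin \o f) <= eps%:E)%E ->
  (\int[mu]_x (f x ^+ 2)%:E <= (eps ^+ 2)%:E)%E.
Proof.
move=> eps0 h.
have -> : (\int[mu]_x (f x ^+ 2)%:E = (Lnorm mu 2%:E (EFin \o f)) `^ 2)%E.
  rewrite poweR_Lnorm//; apply: eq_integral => x _.
  by rewrite /= powR_mulrn// real_normK// num_real.
have -> : ((eps ^+ 2)%:E = eps%:E `^ 2)%E by rewrite poweR_EFin powR_mulrn.
by apply: gt0_ler_poweR => //; rewrite in_itv /= leey ?Lnorm_ge0 ?lee_fin ?andbT.
Qed.

(** A vector [h] of the complement has no component in [Q0], so [r] and [r - h] have the same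
    projection. *)
Let projQ_le h r : M h ->
  `|orthogonal_projection ip Q0 r| ^+ 2 <= `|h - r| ^+ 2.
Proof.
move=> Mh.
have -> : orthogonal_projection ip Q0 r = orthogonal_projection ip Q0 (r - h).
  rewrite !(sum_projectionE norm_ip hQ0 he).
  rewrite -[X in r - X - _](projM Mh) /proj -addrA -opprD -big_split /=; congr (_ - _).
  by apply: eq_bigr => i _; rewrite -scalerDl ipBr addrC subrK.
rewrite (sqr_norm_projection norm_ip hQ0 he) (distrC h) gerBl.
by apply: sumr_ge0 => i _; exact: sqr_ge0.
Qed.

Let coord_le h : \sum_i ip (e i) h ^+ 2 <= `|h| ^+ 2.
Proof. by rewrite -subr_ge0 -(sqr_norm_projection norm_ip hQ0 he) sqr_ge0. Qed.

(** The second moment of the standard normal law, kept as a finite nonnegative constant: it only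
    scales errors that tend to 0. *)
Let C : R := fine (\int[@normal_prob R 0 1]_z (z ^+ 2)%:E)%E.

Let CE : (\int[@normal_prob R 0 1]_z (z ^+ 2)%:E)%E = C%:E.
Proof.
rewrite fineK// ge0_fin_numE ?normal_prob_sqr_lty//.
by apply: integral_ge0 => z _; rewrite lee_fin sqr_ge0.
Qed.

Let C0 : 0 <= C.
Proof. by apply: fine_ge0; apply: integral_ge0 => z _; rewrite lee_fin sqr_ge0. Qed.

Let int_ip_sqr h : (\int[gamma]_p (ip h (proj p) ^+ 2)%:E <= (`|h| ^+ 2 * C)%:E)%E.
Proof.
rewrite (gaussian_sqr (mip_proj h) (s := Num.sqrt (\sum_i ip (e i) h ^+ 2))); last first.
  by move=> t a; exact: gamma_cos.
rewrite CE -EFinM lee_fin ler_wpM2r// sqr_sqrtr ?coord_le//.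
by apply: sumr_ge0 => i _; exact: sqr_ge0.
Qed.

Let int_xs_sqr (xs : {scalar B}) : continuous (xs : B -> R) ->
  (\int[muQ 0%R]_y (xs y ^+ 2)%:E =
   (`|orthogonal_projection ip Q0 (rv xs)| ^+ 2 * C)%:E)%E.
Proof.
move=> cxs; rewrite (gaussian_sqr (mfunc cxs)
  (s := `|orthogonal_projection ip Q0 (rv xs)|)) ?CE//.
by move=> t a; exact: muQ0_cos.
Qed.

(** Continuity of [I] at [h] gives a radius in which the distance in L^2 is finite and small; a
    Riesz vector is chosen inside it by density. There [I (rv xs)] may be replaced by [xs] off a
    null set. *)
Let paley_wiener_approx h (eps : R) : 0 < eps ->
  exists2 xs : {scalar B}, continuous (xs : B -> R) &
    `|h - rv xs| < eps /\
    (\int[mu]_x ((I h x - xs x) ^+ 2)%:E <= (eps ^+ 2)%:E)%E.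
Proof.
move=> eps0; have [_ _ hcvg hxs] := hI.
have /fine_cvgP[fin /cvgrPdist_lt /(_ _ eps0) hlt] := hcvg h.
have /nbhs_ballP[r /= r0 rP] := @filterI _ _ (nbhs_filter h) _ _ fin hlt.
have [|xs cxs hr] := riesz_vector_dense norm_ip cj injj h (eps := Num.min r eps).
  by rewrite lt_min r0.
exists xs => //; move: hr; rewrite lt_min => /andP[hr ->]; split=> //.
have [|Nfin Nlt] := rP (rv xs); first by rewrite -ball_normE.
have N0 := Lnorm_ge0 mu 2%:E (fun x => (I (rv xs) x - I h x)%:E).
rewrite (@ge0_ae_eq_integral _ _ _ mu setT _
  (fun x => ((I (rv xs) x - I h x) ^+ 2)%:E))//.
- apply: Lnorm2_sqr; first exact: ltW.
  rewrite -(fineK Nfin) lee_fin; apply: ltW; apply: le_lt_trans Nlt.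
  by rewrite sub0r normrN ler_norm.
- apply/measurable_EFinP; apply: measurable_funX.
  by apply: measurable_funB => //; exact: mfunc.
- by apply/measurable_EFinP; apply: measurable_funX; exact: measurable_funB.
- by move=> x _; rewrite lee_fin sqr_ge0.
- by move=> x _; rewrite lee_fin sqr_ge0.
- have := hxs xs cxs; apply: filterS => x /= -> _.
  by rewrite -sqrrN opprB.
Qed.

Let paley_wiener_ae h : M h -> {ae P, forall z, I h (T z) = ip h (proj z.1)}.
Proof.
move=> Mh; pose D z := I h (T z) - ip h (proj z.1).
have mD : measurable_fun setT D.
  apply: measurable_funB; first exact: measurableT_comp mT.
  exact: (measurableT_comp (mip_proj h) measurable_fst).
have mD2 : measurable_fun setT (fun z => (D z ^+ 2)%:E).
  by apply/measurable_EFinP; exact: measurable_funX.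
have int0 : (\int[P]_z (D z ^+ 2)%:E = 0)%E.
  apply/eqP; rewrite eq_le; apply/andP; split; last first.
    by apply: integral_ge0 => z _; rewrite lee_fin sqr_ge0.
  apply/lee_addgt0Pr => d d0; rewrite add0e.
  (* The square of a sum of three terms is at most three times the sum of their squares. The three
     integrals are at most [eps ^+ 2], [eps ^+ 2 * C] and [eps ^+ 2 * C], and [eps] is set so that
     [K * eps ^+ 2 = d]. *)
  pose K := 3 * (1 + 2 * C).
  have K0 : 0 < K by rewrite /K; have := C0; lra.
  pose eps := Num.sqrt (d / K).
  have eps0 : 0 < eps by rewrite sqrtr_gt0 divr_gt0.
  have eps2 : eps ^+ 2 = d / K by rewrite sqr_sqrtr// ltW// divr_gt0.
  have [xs cxs [hr hmu]] := paley_wiener_approx h eps0.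
  (* [D z] is the sum of three errors: [I h - xs] at [T z], the pairing of [rv xs - h] with
     [proj z.1], and [xs z.2], whose variance is that of the [Q0] component. *)
  pose F1 x := (I h x - xs x) ^+ 2.
  pose F2 p := ip (rv xs - h) (proj p) ^+ 2.
  pose F3 y := xs y ^+ 2.
  have mF1 : measurable_fun setT (fun x => (F1 x)%:E).
    apply/measurable_EFinP; apply: measurable_funX.
    by apply: measurable_funB => //; exact: mfunc.
  have mF2 : measurable_fun setT (fun p : borel H => (F2 p)%:E).
    by apply/measurable_EFinP; apply: measurable_funX.
  have mF3 : measurable_fun setT (fun y : borel B => (F3 y)%:E).
    by apply/measurable_EFinP; apply: measurable_funX; exact: mfunc.
  have mG1 : measurable_fun setT (fun z => (F1 (T z))%:E).
    exact: (measurableT_comp mF1 mT).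
  have mG2 : measurable_fun setT (fun z : borel H * borel B => (F2 z.1)%:E).
    exact: (measurableT_comp mF2 measurable_fst).
  have mG3 : measurable_fun setT (fun z : borel H * borel B => (F3 z.2)%:E).
    exact: (measurableT_comp mF3 measurable_snd).
  have F0 : (forall x, 0 <= (F1 x)%:E)%E /\ (forall x, 0 <= (F2 x)%:E)%E /\
      (forall x, 0 <= (F3 x)%:E)%E.
    by split; [|split] => x; rewrite lee_fin sqr_ge0.
  have [F10 [F20 F30]] := F0.
  apply: (@le_trans _ _ (\int[P]_z
     (3%:E * ((F1 (T z))%:E + (F2 z.1)%:E + (F3 z.2)%:E)))%E).
    apply: ge0_le_integral => //.
    - by move=> z _; rewrite lee_fin sqr_ge0.
    - by apply: measurable_funeM; do 2 apply: emeasurable_funD => //.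
    - move=> z _; rewrite -!EFinD -EFinM lee_fin /D /F1 /F2 /F3 xsT// ipBl.
      set a := I h _; set b := ip h _; set c := ip (rv xs) _; set q := xs _.
      (* These squared pairwise differences add up exactly to the gap in the three-term
         inequality. *)
      have := sqr_ge0 ((a - (c + q)) - (c - b)).
      have := sqr_ge0 ((a - (c + q)) - q).
      have := sqr_ge0 ((c - b) - q).
      by move: a b c q => a b c q; lra.
  rewrite ge0_integralZl//; last 2 first.
  - by do 2 apply: emeasurable_funD => //.
  - by move=> z _; rewrite !adde_ge0.
  rewrite ge0_integralD//; last 2 first.
  - by move=> z _; rewrite adde_ge0.
  - exact: emeasurable_funD.
  rewrite ge0_integralD//.
  rewrite -(integral_law mT mu_law mF1) (prod_integral_fst _ _ mF2)//.
  rewrite (prod_integral_snd _ _ mF3)// int_xs_sqr//.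
  have h2 : `|rv xs - h| ^+ 2 <= eps ^+ 2.
    by rewrite ler_pXn2r ?nnegrE ?(ltW eps0)// distrC ltW.
  have h3 : `|orthogonal_projection ip Q0 (rv xs)| ^+ 2 <= eps ^+ 2.
    by rewrite (le_trans (projQ_le _ Mh))// distrC.
  apply: (@le_trans _ _ (3%:E * ((eps ^+ 2)%:E + (eps ^+ 2 * C)%:E + (eps ^+ 2 * C)%:E))%E).
    rewrite lee_wpmul2l//; apply: leeD; last by rewrite lee_fin ler_wpM2r.
    apply: leeD => //; apply: le_trans (int_ip_sqr _) _.
    by rewrite lee_fin ler_wpM2r.
  rewrite -!EFinD -EFinM lee_fin -(divfK (lt0r_neq0 K0) d) -eps2.
  by rewrite le_eqVlt; apply/orP; left; apply/eqP; rewrite /K; ring.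
have : ae_eq P setT (fun z => (D z ^+ 2)%:E) (cst 0%E).
  apply/(ae_eq_integral_abs _ measurableT mD2); rewrite -[RHS]int0.
  by apply: eq_integral => z _; rewrite gee0_abs// lee_fin sqr_ge0.
apply: filterS => z /(_ Logic.I) [] /eqP; rewrite sqrf_eq0 subr_eq0 => /eqP; exact.
Qed.

Let measurable_M : measurable (M : set (borel H)).
Proof.
have cM : closed (M : set H).
  rewrite (_ : M = \bigcap_(q in Q0) (ip q @^-1` [set 0])).
    apply: closed_bigI => q _; apply: preimage_closed; last exact: closed_eq.
    by move=> x _; exact: ip_continuous.
  by apply/seteqP; split=> p Mp q Qq; exact: Mp.
rewrite -(setCK M); apply: measurableC; apply: sub_sigma_algebra.
exact: closed_openC.
Qed.

(** * One real term of the transform *)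

Section Term.
(** [K a b] stands for [expR a * cos b] or [expR a * sin b], and [u] for the real or imaginary part
    of [f]; four such terms make up the complex integrand. *)
Variables (h k : H) (K : R -> R -> R) (u : borel B -> R).
Hypothesis Mh : M h.
Hypothesis Mk : M k.
Hypothesis KE : forall a b, `|K a b| <= expR a.
Hypothesis mK : forall d (S : measurableType d) (X Y : S -> R),
  measurable_fun setT X -> measurable_fun setT Y ->
  measurable_fun setT (fun s => K (X s) (Y s)).
Hypothesis hu : u \in Lfun mu 2%:E.

Let mu_u : measurable_fun setT u.
Proof. by move: hu; rewrite inE => /andP[/set_mem]. Qed.

Let kap (p : borel H) : R := K (ip h (proj p)) (ip k (proj p)).
Let F (x : borel B) : R := K (I h x) (I k x) * u x.
Let G (z : borel H * borel B) : R := kap z.1 * u (T z).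

Let mkap : measurable_fun setT (kap : borel H -> R).
Proof. by apply: mK. Qed.

Let mF : measurable_fun setT F.
Proof. by apply: measurable_funM => //; exact: mK. Qed.

Let muT : measurable_fun setT (fun z => u (T z)).
Proof. exact: measurableT_comp mT. Qed.

Let mG : measurable_fun setT G.
Proof. by apply: measurable_funM => //; exact: (measurableT_comp mkap measurable_fst). Qed.

Let i_uT : P.-integrable setT (fun z => (u (T z))%:E).
Proof.
apply: (integral_law_integrable (f := EFin \o u) mT mu_law).
apply/Lfun1_integrable; apply: (@Lfun_subset12 _ _ _ mu) => //.
exact: fin_num_measure.
Qed.

Let i_exp : P.-integrable setT (fun z => (expR (2 * ip h (proj z.1)))%:E).
Proof.
have mexp : measurable_fun setT (fun p : borel H => (expR (2 * ip h (proj p)))%:E).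
  apply/measurable_EFinP/measurableT_comp; first exact: measurable_expR.
  exact: measurable_funM.
apply/integrableP; split; first exact: (measurableT_comp mexp measurable_fst).
under eq_integral do rewrite gee0_abs ?lee_fin ?expR_ge0//.
rewrite (prod_integral_fst _ _ mexp); last by move=> p; rewrite lee_fin expR_ge0.
rewrite (gaussian_expR (mip_proj h) (s := Num.sqrt (\sum_i ip (e i) h ^+ 2))) ?ltry//.
Qed.

Let iG : P.-integrable setT (fun z => (G z)%:E).
Proof.
have i_u2 : P.-integrable setT (fun z => (u (T z) ^+ 2)%:E).
  apply: (integral_law_integrable (f := fun x => (u x ^+ 2)%:E) mT mu_law).
  exact: Lfun2_integrable_sqr hu.
have := integrableD measurableT i_exp i_u2; apply: le_integrable => //.
  exact/measurable_EFinP.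
move=> z _ /=; rewrite lee_fin /G normrM [leRHS]ger0_norm; last first.
  by rewrite addr_ge0 ?expR_ge0 ?sqr_ge0.
have := KE (ip h (proj z.1)) (ip k (proj z.1)); rewrite -/(kap z.1).
have -> : expR (2 * ip h (proj z.1)) = expR (ip h (proj z.1)) ^+ 2.
  by rewrite expr2 -expRD mulr_natl mulr2n.
have k0 := normr_ge0 (kap z.1); have u0 := normr_ge0 (u (T z)).
rewrite -(real_normK (num_real (u (T z)))).
move: `|kap z.1| `|u (T z)| (expR (ip h (proj z.1))) k0 u0 => a b c a0 b0 ac.
have : a * b <= c * b by rewrite ler_wpM2r.
have := sqr_ge0 (c - b); have := sqr_ge0 c; have := sqr_ge0 b; lra.
Qed.

Let FTG : {ae P, forall z, F (T z) = G z}.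
Proof.
have h1 := paley_wiener_ae Mh; have h2 := paley_wiener_ae Mk.
by apply: filterS2 h1 h2 => z e1 e2; rewrite /F /G /kap e1 e2.
Qed.

(** [mu] is the law of [T] and [F] composed with [T] is almost everywhere [G], so integrability is
    carried over from the product space. *)
Let iF : mu.-integrable setT (EFin \o F).
Proof.
apply/integrableP; split; first exact/measurable_EFinP.
have mabsF : measurable_fun setT (fun x => `|(F x)%:E|%E).
  by apply: measurableT_comp => //; exact/measurable_EFinP.
rewrite (integral_law mT mu_law mabsF).
have /integrableP[_] := iG; apply: le_lt_trans.
rewrite (@ge0_ae_eq_integral _ _ _ P setT _ (fun z => `|(G z)%:E|%E))//.
- exact: (measurableT_comp mabsF mT).
- by apply: measurableT_comp => //; exact/measurable_EFinP.
- by apply: filterS FTG => z /= -> _.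
Qed.

Let inner (p : borel H) : \bar R := (\int[muQ 0%R]_y (G (p, y))%:E)%E.

Let integralF : (\int[mu]_x (F x)%:E = \int[gamma]_p inner p)%E.
Proof.
rewrite (integral_law mT mu_law); last exact/measurable_EFinP.
rewrite -(prod_fubini iG); apply: ae_eq_integral => //.
- by apply/measurable_EFinP; exact: (measurableT_comp mF mT).
- exact/measurable_EFinP.
- by apply: filterS FTG => z /= -> _.
Qed.

(** A measurable real version of the integrand on the [gamma] side, defined on all of [H] although
    [muQ p] is described only for [p] in the complement. [fine] supplies a value on the null set
    where the fibre integral may fail to be finite. *)
Let g' (p : borel H) : R := kap p * fine (\int[muQ 0%R]_y (u (T (p, y)))%:E)%E.

Let mg' : measurable_fun setT (g' : borel H -> R).
Proof.
apply: measurable_funM => //; apply: measurableT_comp => //.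
exact: (prod_measurable_fubini i_uT).
Qed.

Let minner : measurable_fun setT (inner : borel H -> \bar R).
Proof. exact: (prod_measurable_fubini iG). Qed.

Let g'_inner : {ae gamma, forall p, (g' p)%:E = inner p}.
Proof.
have := prod_ae_integrable i_uT; apply: filterS => p ip_.
rewrite /inner /G /=; under eq_integral do rewrite EFinM.
rewrite integralZl// /g' EFinM fineK//; exact: integrable_fin_num.
Qed.

Let i_g' : gamma.-integrable setT (fun p => (g' p)%:E).
Proof.
apply/integrableP; split; first exact/measurable_EFinP.
have /integrableP[_] : gamma.-integrable setT inner by exact: (integrable_fubini_F iG).
apply: le_lt_trans.
rewrite (@ge0_ae_eq_integral _ _ _ gamma setT _ (fun p => `|inner p|%E))//.
- by apply: measurableT_comp => //; exact/measurable_EFinP.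
- exact: measurableT_comp.
- by apply: filterS g'_inner => z e_ _; rewrite e_.
Qed.

(** Both sides take [fine] of the same extended integral, so they agree at every [p] of the
    complement, even where [u] is not integrable for [muQ p]. *)
Let g'E p : M p -> K (ip h p) (ip k p) * \int[muQ p]_x u x = g' p.
Proof.
move=> Mp; rewrite /g' /kap projM//; congr (_ * _).
have mTp : measurable_fun setT ((fun y => T (p, y)) : borel B -> borel B).
  exact: (measurableT_comp mT (measurable_pair1 (p : borel H))).
by rewrite (Rintegral_law mTp (fun A mA => muQ_law Mp mA)).
Qed.
Lemma integrable_weighted : mu.-integrable setT (EFin \o (fun x => K (I h x) (I k x) * u x)).
Proof. exact: iF. Qed.

Lemma integrable_weighted_radon :
  gamma.-integrable M (EFin \o (fun p => K (ip h p) (ip k p) * \int[muQ p]_x u x)).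
Proof.
have : gamma.-integrable M (fun p => (g' p)%:E).
  exact: (integrableS measurableT measurable_M (@subsetT _ _) i_g').
apply: eq_integrable => // p /set_mem Mp; congr (_%:E).
by rewrite g'E.
Qed.

Lemma integral_weighted_radon :
  \int[gamma]_(p in M) (K (ip h p) (ip k p) * \int[muQ p]_x u x) =
  \int[mu]_x (K (I h x) (I k x) * u x).
Proof.
(* [gamma] is carried by [M], hence the integral over [M] required by the transform equals the one
   over [H] produced by Fubini. *)
have gammaMC : gamma (~` M) = 0%E.
  have := probability_setC gamma measurable_M.
  by rewrite [X in (_ - X)%E](_ : _ = 1%E) ?subee.
transitivity (\int[gamma]_(p in M) g' p).
  by apply: eq_Rintegral => p /set_mem Mp; rewrite g'E.
congr fine; rewrite integralF.
rewrite -(@ae_eq_integral _ _ _ gamma setT _ (fun p => (g' p)%:E))//.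
- rewrite [RHS](@negligible_integral _ _ _ gamma setT (~` M))//; last exact: measurableC.
  by rewrite setTD setCK.
- exact/measurable_EFinP.
- by apply: filterS g'_inner => p e_ _; rewrite e_.
Qed.
End Term.

Let measurable_expR_cos d (S : measurableType d) (X Y : S -> R) :
  measurable_fun setT X -> measurable_fun setT Y ->
  measurable_fun setT (fun s => expR (X s) * cos (Y s)).
Proof.
move=> mX mY; apply: measurable_funM; apply: measurableT_comp => //.
exact: continuous_measurable_fun (@continuous_cos R).
Qed.

Let measurable_expR_sin d (S : measurableType d) (X Y : S -> R) :
  measurable_fun setT X -> measurable_fun setT Y ->
  measurable_fun setT (fun s => expR (X s) * sin (Y s)).
Proof.
move=> mX mY; apply: measurable_funM; apply: measurableT_comp => //.
exact: continuous_measurable_fun (@continuous_sin R).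
Qed.

Let expR_cos_le (a b : R) : `|expR a * cos b| <= expR a.
Proof.
rewrite normrM ger0_norm ?expR_ge0// ler_piMr ?expR_ge0//.
by rewrite ler_norml cos_geN1 cos_le1.
Qed.

Let expR_sin_le (a b : R) : `|expR a * sin b| <= expR a.
Proof.
rewrite normrM ger0_norm ?expR_ge0// ler_piMr ?expR_ge0//.
by rewrite ler_norml sin_geN1 sin_le1.
Qed.

Lemma segal_bargmann_radon (f : borel B -> R[i]) (z : complexification H) :
  cL2 mu f -> M z.1 -> M z.2 ->
  segal_bargmann_fin ip M gamma (gaussian_radon muQ f) z = segal_bargmann ip mu I f z.
Proof.
move=> [fre fim] M1 M2; rewrite /segal_bargmann_fin /segal_bargmann; congr (_ * _).
have bilE p : bilinear_ext ip z (to_complexification p) = ip z.1 p +i* ip z.2 p.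
  by rewrite /bilinear_ext /= !ip0r subr0 add0r.
pose c a b : R := expR a * cos b; pose s a b : R := expR a * sin b.
(* Each term comes with integrability on both sides besides the equality: linearity splits the left
   integral into two terms and reassembles them on the right. *)
have tc u (hu : u \in Lfun mu 2%:E) := conj
  (integrable_weighted (K := c) M1 M2 expR_cos_le (@measurable_expR_cos) hu)
  (conj (integrable_weighted_radon z.1 z.2 (K := c) expR_cos_le (@measurable_expR_cos) hu)
  (integral_weighted_radon (K := c) M1 M2 expR_cos_le (@measurable_expR_cos) hu)).
have ts u (hu : u \in Lfun mu 2%:E) := conj
  (integrable_weighted (K := s) M1 M2 expR_sin_le (@measurable_expR_sin) hu)
  (conj (integrable_weighted_radon z.1 z.2 (K := s) expR_sin_le (@measurable_expR_sin) hu)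
  (integral_weighted_radon (K := s) M1 M2 expR_sin_le (@measurable_expR_sin) hu)).
have [c1 [c2 c3]] := tc _ fre; have [c4 [c5 c6]] := tc _ fim.
have [s1 [s2 s3]] := ts _ fre; have [s4 [s5 s6]] := ts _ fim.
rewrite /cintegral; congr (_ +i* _).
- transitivity (\int[gamma]_(p in M) (c (ip z.1 p) (ip z.2 p) * \int[muQ p]_x complex.Re (f x)
     - s (ip z.1 p) (ip z.2 p) * \int[muQ p]_x complex.Im (f x))).
    by apply: eq_Rintegral => p _; rewrite bilE.
  rewrite (RintegralB measurable_M c2 s5) c3 s6 -(RintegralB measurableT c1 s4).
  by apply: eq_Rintegral => x _; case: (f x).
- transitivity (\int[gamma]_(p in M) (c (ip z.1 p) (ip z.2 p) * \int[muQ p]_x complex.Im (f x)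
     + s (ip z.1 p) (ip z.2 p) * \int[muQ p]_x complex.Re (f x))).
    by apply: eq_Rintegral => p _; rewrite bilE.
  rewrite (RintegralD measurable_M c5 s2) c6 s3 -(RintegralD measurableT c4 s1).
  by apply: eq_Rintegral => x _; case: (f x).
Qed.
End Disintegration.

Theorem theorem4p1 (R : realType) (H B : completeNormedModType R)
  (ip : {dot H for idfun}) (j : {linear H -> B})
  (mu : probability (borel B) R)
  (hW : abstract_wiener_space ip j mu)
  (I : H -> borel B -> R) (hI : paley_wiener ip j mu I)
  (f : borel B -> R[i]) (hf : cL2 mu f)
  (Q0 : set H) (hQ0 : closed_subspace Q0) (hcodim : finite_codimension Q0)
  (gamma : probability (borel H) R)
  (hgamma : standard_gaussian ip (orthogonal_complement ip Q0) gamma)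
  (muQ : H -> probability (borel B) R)
  (hmuQ : forall p, orthogonal_complement ip Q0 p ->
            affine_gaussian ip j Q0 p (muQ p))
  (n : nat) (u : 'I_n -> H)
  (hu : orthonormal_basis ip (orthogonal_complement ip Q0) u)
  (alpha : 'I_n -> R[i]) :
  let alphaQ := \sum_i alpha i *: to_complexification (u i) in
  segal_bargmann_fin ip (orthogonal_complement ip Q0) gamma
    (gaussian_radon muQ f) alphaQ
  = segal_bargmann ip mu I f alphaQ.
Proof.
move=> alphaQ.
(* The Gaussian measure brings its own orthonormal basis [e], in which the computations run; [u]
   enters by placing both components of [alphaQ] in the complement. *)
have [gM [m [e [he hrect]]]] := hgamma.
have Mlin := @orthogonal_complement_lin _ _ ip Q0.
have M0 : orthogonal_complement ip Q0 0 by move=> q _; rewrite ip0r.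
have [M1 M2] : orthogonal_complement ip Q0 alphaQ.1 /\
    orthogonal_complement ip Q0 alphaQ.2.
  apply: (big_ind (fun z : complexification H =>
    orthogonal_complement ip Q0 z.1 /\ orthogonal_complement ip Q0 z.2)) => //.
  - move=> x y [x1 x2] [y1 y2]; split.
    + by have := Mlin 1 _ _ x1 y1; rewrite scale1r.
    + by have := Mlin 1 _ _ x2 y2; rewrite scale1r.
  - move=> i _; have Mu := orthogonal_complement_basis hu i; split => /=.
    + by have := Mlin (complex.Re (alpha i)) _ _ Mu M0; rewrite scaler0 subr0 addr0.
    + by have := Mlin (complex.Im (alpha i)) _ _ Mu M0; rewrite scaler0 add0r addr0.
exact: (segal_bargmann_radon hW hQ0 he gM hrect hmuQ hI hf M1 M2).
Qed.
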